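(* Let $G=(V,E,\omega)$ be an undirected graph with $n$ vertices, positive integer edge weights, minimal distance $1$ and diameter $\Lambda$, and let $2\le\kappa\le(\log n)/4$, $1/2>\rho\ge1/\kappa$, $1\le t\le\log\Lambda$ and $0<\epsilon<1$. There is a randomized distributed algorithm in the Congested Clique model that computes a $(\beta,\epsilon)$-hopset $H$ for $G$ with expected size $O(n^{1+1/\kappa}\cdot\log\Lambda)$ in $O(n^\rho/\rho\cdot\log n\cdot\beta\cdot\log\Lambda\cdot 2^t)$ rounds with high probability, where $\beta=O\left(\frac{(\log\kappa+1/\rho)\log\Lambda}{\epsilon\cdot t}\right)^{\log\kappa+1/\rho}$. Moreover, for any scale $k$, a single-scale hopset (one satisfying $d_G(u,v)\le d^{(\beta)}_{G\cup H_k}(u,v)$ for all $u,v$, and $d^{(\beta)}_{G\cup H_k}(u,v)\le(1+\epsilon)d_G(u,v)$ for all $u,v$ with $d_G(u,v)\in(2^k,2^{k+1}]$) with expected size $O(n^{1+1/\kappa})$ and the same $\beta$ can be constructed within the same running time.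
   Context: $d_G$ is shortest-path distance; $d^{(\beta)}_{G'}(u,v)$ is the minimum length of a $u$–$v$ path in $G'$ using at most $\beta$ edges. A set $H$ of weighted edges on $V$ is a $(\beta,\epsilon)$-hopset if $d_G(u,v)\le d^{(\beta)}_{G\cup H}(u,v)\le(1+\epsilon)d_G(u,v)$ for all $u,v$, where $G\cup H$ has edge set $E\cup H$ with hopset weights on $H$. Congested Clique model: each vertex hosts a processor; computation proceeds in synchronous rounds; in each round every vertex may send a (possibly different) message to every other vertex; each message may contain a constant number of vertex/edge identities and edge weights; local computation is free; each vertex initially knows its incident edges of $G$ and their weights. ''With high probability'' means with probability $1-n^{-c}$ for a constant $c>0$. *)

(* Defs.v *)
From mathcomp Require Import all_boot all_order all_algebra.
From mathcomp Require Import classical_sets reals ereal exp.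

Set Implicit Arguments.
Unset Strict Implicit.
Unset Printing Implicit Defensive.

Import Order.TTheory GRing.Theory Num.Theory.

Local Open Scope ring_scope.

Definition log2 (R : realType) (x : R) : R := ln x / ln 2.

(* Finite undirected graphs on {0, ..., n-1} with positive integer weights.
   [wt G u v = 0] encodes the absence of an edge.  The same type is used for
   input graphs and for sets of weighted hopset edges. *)
Record wgraph (n : nat) := WGraph {
  wt :> 'I_n -> 'I_n -> nat;
  wt_sym : forall u v, wt u v = wt v u;
  wt_irr : forall u, wt u u = 0%N }.

Section Graphs.
Variable n : nat.
Implicit Types (G H : wgraph n) (u v : 'I_n) (p : seq 'I_n).

Definition adj G : rel 'I_n := [rel u v | G u v != 0%N].

Definition num_edges G : nat :=
  #|[set e : 'I_n * 'I_n | (e.1 < e.2)%N && adj G e.1 e.2]|.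

Definition union_wt G H u v : nat := if adj H u v then H u v else G u v.

Fact union_wt_sym G H u v : union_wt G H u v = union_wt G H v u.
Proof. by rewrite /union_wt /adj /= (wt_sym H u v) (wt_sym G u v). Qed.

Fact union_wt_irr G H u : union_wt G H u u = 0%N.
Proof. by rewrite /union_wt /adj /= (wt_irr H u) (wt_irr G u). Qed.

(* An edge present in both graphs gets its weight from [H]. *)
Definition gunion G H : wgraph n :=
  WGraph (union_wt_sym G H) (@union_wt_irr G H).

(* The path visiting u and then, in order, the vertices of p;
   it has [size p] edges. *)
Definition path_between G u v p : bool := path (adj G) u p && (last u p == v).

Fixpoint path_length G u p : nat :=
  if p is x :: p' then (G u x + path_length G x p')%N else 0%N.

Variable R : realType.

(* The infima below are minima, or +oo when there is no such path. *)
Definition dist G u v : \bar R :=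
  ereal_inf [set ((path_length G u p)%:R : R)%:E
            | p in [set p | path_between G u v p]]%classic.

Definition hop_dist (beta : nat) G u v : \bar R :=
  ereal_inf [set ((path_length G u p)%:R : R)%:E
            | p in [set p | path_between G u v p /\ (size p <= beta)%N]]%classic.

Definition diameter G : \bar R :=
  ereal_sup [set dist G uv.1 uv.2 | uv in [set: 'I_n * 'I_n]]%classic.

Definition min_distance G : \bar R :=
  ereal_inf [set dist G uv.1 uv.2
            | uv in [set uv : 'I_n * 'I_n | uv.1 != uv.2]]%classic.

Definition is_hopset (beta : nat) (eps : R) G H : Prop :=
  forall u v,
    (dist G u v <= hop_dist beta (gunion G H) u v)%E /\
    (hop_dist beta (gunion G H) u v <= (1 + eps)%:E * dist G u v)%E.

Definition is_scale_hopset (beta : nat) (eps : R) (k : nat) G H : Prop :=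
  (forall u v, (dist G u v <= hop_dist beta (gunion G H) u v)%E) /\
  (forall u v,
    ((2 ^+ k)%:E < dist G u v)%E -> (dist G u v <= (2 ^+ k.+1)%:E)%E ->
    (hop_dist beta (gunion G H) u v <= (1 + eps)%:E * dist G u v)%E).

End Graphs.

Section CongestedClique.

(* A word is a vertex identity or a weight at most W; a message has at most
   K words, the empty message meaning that nothing is sent.  Weights must be
   bounded: one unbounded integer could encode the whole graph. *)
Definition word (n W : nat) : Type := ('I_n + 'I_W.+1)%type.
Definition message (n W K : nat) : Type := K.-bseq (word n W).

(* What is known to v: its incident edges, with their weights. *)
Definition local_view (n : nat) (G : wgraph n) (v : 'I_n) :
  {ffun 'I_n -> nat} := [ffun u => G v u].

(* A randomized algorithm for n processors.  Each processor starts with its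
   local view of the input graph and [cc_bits] private random bits; it has
   halted once [cc_output] is defined on its state, and the output is then
   its local view of the output graph.  The record cannot mention the input
   graph. *)
Record cc_alg (n W K : nat) := CCAlg {
  cc_bits : nat;
  cc_state : Type;
  cc_init : 'I_n -> {ffun 'I_n -> nat} -> cc_bits.-tuple bool -> cc_state;
  cc_send : 'I_n -> cc_state -> 'I_n -> message n W K;
  cc_recv : 'I_n -> cc_state -> {ffun 'I_n -> message n W K} -> cc_state;
  cc_output : cc_state -> option {ffun 'I_n -> nat} }.

Arguments cc_bits {n W K} A : rename.
Arguments cc_state {n W K} A : rename.
Arguments cc_init {n W K} A v _ _ : rename.
Arguments cc_send {n W K} A v s u : rename.
Arguments cc_recv {n W K} A v s _ : rename.
Arguments cc_output {n W K} A s : rename.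

Variables (n W K : nat) (A : cc_alg n W K).

Definition coins : finType := {ffun 'I_n -> (cc_bits A).-tuple bool}.

Definition halted (s : cc_state A) : bool := isSome (cc_output A s).

(* A halted processor keeps its state and sends nothing. *)
Definition cc_step (s : 'I_n -> cc_state A) (v : 'I_n) : cc_state A :=
  if halted (s v) then s v
  else cc_recv A v (s v)
         [ffun u => if halted (s u) then [bseq] else cc_send A u (s u) v].

Definition cc_run (G : wgraph n) (w : coins) (T : nat) : 'I_n -> cc_state A :=
  iter T cc_step (fun v => cc_init A v (local_view G v) (w v)).

Definition computes_in (G : wgraph n) (w : coins) (T : nat) (H : wgraph n) :
  Prop := forall v, cc_output A (cc_run G w T v) = Some (local_view H v).

End CongestedClique.

(* Probability and expectation for the uniform distribution. *)
Definition prob (R : realType) (Omega : finType) (E : pred Omega) : R :=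
  #|E|%:R / #|Omega|%:R.

Definition expectation (R : realType) (Omega : finType) (X : Omega -> R) : R :=
  (\sum_(w : Omega) X w) / #|Omega|%:R.

(* On input G, the output always satisfies [spec], its expected number of
   edges is at most [size_bound], and the number of rounds is at most
   [round_bound] with probability at least 1 - n^(-c). *)
Definition solves (R : realType) (n W K : nat) (A : cc_alg n W K)
    (G : wgraph n) (spec : wgraph n -> Prop) (size_bound round_bound c : R) :
    Prop :=
  exists (H : coins A -> wgraph n) (T : coins A -> nat),
    [/\ forall w, computes_in G w (T w) (H w),
        forall w, spec (H w),
        expectation (fun w => (num_edges (H w))%:R) <= size_bound
      & 1 - n%:R `^ (- c) <= prob R (fun w => (T w)%:R <= round_bound)].

(* Main.v *)
(* In the superclustering-and-interconnection hopset construction (Elkin and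
   Neiman), the clusters that become supercluster centers can be chosen
   greedily, so that no randomness is needed.  Fix a scale R = 2^(k+1).  In
   phase i every vertex learns its s_i closest centers within a distance
   threshold, by a Bellman-Ford exploration that keeps only the s_i best
   entries; this costs s_i rounds of broadcasting per hop, and few hops suffice
   thanks to the hopsets of the smaller scales.  A center with a full list is
   popular.  A maximal family of popular centers with pairwise disjoint lists
   is kept for the next phase: there are at most |P_i| / s_i of them, and each
   popular center shares a list entry with one of them, to which it is joined
   by an edge; an unpopular center is joined to all the centers of its list.
   Since all messages are broadcast and local computation is free, every
   processor can carry out these choices.

   For the stretch, cut a path into segments whose lengths decrease by a
   factor M from one level to the next.  On a path of level i, jump from the
   first to the last vertex whose supercluster stopped at phase i, through the
   edge joining their centers, and treat what remains at level i - 1.  The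
   additive errors add up to O(l R / M) over the l phases, and the number of
   hops is at most (3 M)^l.  The scales are handled in groups of t: a path
   that is 2^t times longer than those of the previous groups takes O(2^t)
   times more hops, and only the O(log Lambda / t) groups contribute to the
   accumulated error. *)
Require Import Defs.
From mathcomp Require Import classical_sets reals ereal exp boolp.
From mathcomp Require Import all_boot all_order all_algebra archimedean.
From mathcomp Require Import zify ring lra.

Set Implicit Arguments.
Unset Strict Implicit.
Unset Printing Implicit Defensive.

Import Order.TTheory GRing.Theory Num.Theory.

Local Open Scope nat_scope.

(** * Walks, metrics and hopset graphs *)

Section Walks.
Variable n : nat.
Implicit Types (X G : wgraph n) (a b : pred 'I_n) (u v w x y : 'I_n).

Lemma adjE X u v : adj X u v = (X u v != 0).
Proof. by []. Qed.

(** The index [h] is only an upper bound on the number of edges, whereas [D] is the exact length.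
    The predicate [a] confines a path to vertices of a given level in the stretch argument. *)
Inductive walk a X : nat -> nat -> 'I_n -> 'I_n -> Prop :=
| walk_nil h u : a u -> walk a X h 0 u u
| walk_cons h D u v w : a u -> adj X u v -> walk a X h D v w ->
    walk a X h.+1 (X u v + D) u w.

Lemma walk_inv a X h D u v : walk a X h D u v -> (u = v /\ D = 0) \/
  exists h' w D', [/\ h = h'.+1, adj X u w, walk a X h' D' w v & D = X u w + D'].
Proof.
by case=> [*|h' D' x y w _ xy wk]; [left|right; exists h', y, D'].
Qed.

Lemma walk_ends a X h D u v : walk a X h D u v -> a u /\ a v.
Proof. by elim=> [//|h' D' u' v' w' au _ _ [_ aw]]. Qed.

Lemma walk_weaken a b X h h' D u v :
  subpred a b -> h <= h' -> walk a X h D u v -> walk b X h' D u v.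
Proof.
move=> sab + wk; elim: wk h' => [{}h {}u au h' _|{}h {}D {}u {}v w au uv _ IH [//|h']
  hh'].
  by apply/walk_nil/sab.
by apply: walk_cons; [exact: sab| |exact: IH].
Qed.

Lemma walk_cat a X h1 h2 D1 D2 u v w : walk a X h1 D1 u v ->
  walk a X h2 D2 v w -> walk a X (h1 + h2) (D1 + D2) u w.
Proof.
move=> wk wk2; elim: wk wk2 => [h u' au|h D u' v' w' au uv _ IH] wk2.
  by apply: walk_weaken wk2; rewrite ?leq_addl.
by rewrite -addnA addSn; apply: walk_cons => //; exact: IH.
Qed.

Lemma walk_edge a X u v : a u -> a v -> adj X u v -> walk a X 1 (X u v) u v.
Proof.
by move=> au av uv; rewrite -[X u v]addn0; apply: walk_cons => //; exact: walk_nil.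
Qed.

Lemma adjC X u v : adj X u v = adj X v u.
Proof. by rewrite !adjE wt_sym. Qed.

Lemma walk_sym a X h D u v : walk a X h D u v -> walk a X h D v u.
Proof.
elim=> [*|h' D' u' v' w' au uv wk IH]; first exact: walk_nil.
rewrite addnC -addn1; apply: walk_cat IH _; rewrite wt_sym.
by apply: walk_edge => //; [case: (walk_ends wk)|rewrite adjC].
Qed.

Lemma walk_pathP X h D u v : walk predT X h D u v <->
  exists p, [/\ path_between X u v p, size p <= h & path_length X u p = D].
Proof.
split.
  elim=> [h' u' _|h' D' u' v' w' _ uv _ [p [/andP[pv lp] sp pl]]].
    by exists [::]; rewrite /path_between /=.
  by exists (v' :: p); rewrite /path_between /= in uv pv lp *; rewrite uv pv lp pl;
    split.
case=> p; elim: p h D u => [|w p IH] h D u [/andP[/= pu lu] sp pl].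
  by rewrite -pl -(eqP lu); apply: walk_nil.
case: h sp => // h sp; case/andP: pu => uw pw.
rewrite -pl; apply: walk_cons => //; apply: IH; split=> //.
by rewrite /path_between pw.
Qed.

(* [pre a h D u x]: a walk of length D from u whose vertices satisfy a, except
   possibly for its last vertex x. *)
Definition pre a X h D u x : Prop :=
  (u = x /\ D = 0) \/
  exists w D', [/\ walk a X h D' u w, adj X w x & D = D' + X w x].

Lemma walk_split_first a b X h D u v : walk b X h D u v ->
  walk a X h D u v \/
  exists x D1 D2, [/\ pre a X h D1 u x, ~~ a x, walk b X h D2 x v & D = D1 + D2].
Proof.
elim=> [{}h {}u bu|{}h {}D {}u w {}v bu uw wk IH].
  have [au|nau] := boolP (a u); first by left; apply: walk_nil.
  by right; exists u, 0, 0; split=> //; [left|apply: walk_nil].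
have [au|nau] := boolP (a u); last first.
  right; exists u, 0, (X u w + D); split=> //; first by left.
  exact: walk_cons.
case: IH => [aw|[x [D1 [D2 [pr nax wk2 ->]]]]]; first by left; apply: walk_cons.
right; exists x, (X u w + D1), D2; split=> //; last by rewrite addnA.
- case: pr => [[wx ->]|[z [D' [wk' zx ->]]]]; right.
    by exists u, 0; rewrite -wx addn0; split=> //; apply: walk_nil.
  exists z, (X u w + D'); split=> //; last by rewrite addnA.
  exact: walk_cons.
- exact: walk_weaken wk2.
Qed.

(** The prefix that fits in [L], together with the edge that leaves it, uses up more than [L]; this
    bounds the number of pieces in [walk_segments]. *)
Lemma walk_greedy a X h D L u v : walk a X h D u v ->
  D <= L \/
  exists x y D1 D2, [/\ walk a X h D1 u x, D1 <= L, adj X x y, L < D1 + X x y &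
    walk a X h D2 y v /\ D = D1 + X x y + D2].
Proof.
move=> wk; elim: wk L => [{}h {}u au L|{}h {}D {}u w {}v au uw wk IH L].
  by left.
have [Luw|uwL] := ltnP L (X u w).
  right; exists u, w, 0, D; split=> //; first exact: walk_nil.
  by split=> //; exact: walk_weaken wk.
case: (IH (L - X u w)) => [DL|[x [y [D1 [D2 [wk1 D1L xy Lxy [wk2 DE]]]]]]].
  by left; lia.
right; exists x, y, (X u w + D1), D2; split=> //; try lia.
  exact: walk_cons.
by split; [exact: walk_weaken wk2|lia].
Qed.

(** The first clause makes every distance attained, hence [G] connected. *)
Definition is_metric_of G (d : 'I_n -> 'I_n -> nat) : Prop :=
  (forall u v, exists h, walk predT G h (d u v) u v) /\
  (forall h D u v, walk predT G h D u v -> d u v <= D).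

Section Metric.
Variables (G : wgraph n) (d : 'I_n -> 'I_n -> nat).
Hypothesis dG : is_metric_of G d.

Lemma gmetric_le a h D u v : walk a G h D u v -> d u v <= D.
Proof. by move=> wk; apply: (dG.2 h); apply: walk_weaken wk. Qed.

Lemma gmetric_refl u : d u u = 0.
Proof. by apply/eqP; rewrite -leqn0; apply: (dG.2 0); exact: walk_nil. Qed.

Lemma gmetric_sym u v : d u v = d v u.
Proof.
suff le x y : d x y <= d y x by apply/eqP; rewrite eqn_leq !le.
by have [h wk] := dG.1 y x; apply: (dG.2 h); apply: walk_sym.
Qed.

Lemma gmetric_triangle v u w : d u w <= d u v + d v w.
Proof.
have [h1 w1] := dG.1 u v; have [h2 w2] := dG.1 v w.
by apply: (dG.2 (h1 + h2)); apply: walk_cat w1 w2.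
Qed.

Lemma gmetric_edge u v : adj G u v -> d u v <= G u v.
Proof. by move=> uv; apply: (dG.2 1); apply: walk_edge. Qed.

Lemma gmetric_gt0 u v : u != v -> 0 < d u v.
Proof.
have [h] := dG.1 u v; move: (d u v) => e; case=> [h' x _|h' D x y w _ xy _ _].
  by rewrite eqxx.
by rewrite addn_gt0 lt0n -adjE xy.
Qed.

End Metric.

(** * Lists of weighted edges as graphs *)

Definition edge : Type := ('I_n * 'I_n * nat)%type.

Implicit Types (E : seq edge).

Definition edge_weights E u v : seq nat :=
  [seq e.2 | e <- E & (e.1 == (u, v)) || (e.1 == (v, u))].

Definition lightest E u v : nat :=
  if edge_weights E u v is w :: s then foldr minn w s else 0.

(* An edge of E no lighter than the one of the input graph is dropped, since
   [gunion] gives precedence to its second argument. *)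
Definition hop_row E v (g : {ffun 'I_n -> nat}) : {ffun 'I_n -> nat} :=
  [ffun u => if (u == v) || (g u != 0) && (g u <= lightest E v u) then 0
             else lightest E v u].

Definition hop_wt G E u v := hop_row E u (local_view G u) v.

Lemma lightestC E u v : lightest E u v = lightest E v u.
Proof. by congr (if map _ _ is _ :: _ then _ else _); apply: eq_filter => e;
  rewrite orbC. Qed.

Fact hop_wt_sym G E u v : hop_wt G E u v = hop_wt G E v u.
Proof. by rewrite /hop_wt !ffunE eq_sym wt_sym lightestC. Qed.

Fact hop_wt_irr G E u : hop_wt G E u u = 0.
Proof. by rewrite /hop_wt !ffunE eqxx. Qed.

Definition hop_graph G E : wgraph n := WGraph (hop_wt_sym G E) (hop_wt_irr G E).

Definition augment G E : wgraph n := gunion G (hop_graph G E).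

Lemma foldr_minn_mem (w : nat) (s : seq nat) : foldr minn w s \in w :: s.
Proof.
elim: s => [|x s IH] /=; first by rewrite mem_head.
rewrite /minn; case: ifP => _; first by rewrite !inE eqxx orbT.
by move: IH; rewrite !inE => /orP[->//|->]; rewrite !orbT.
Qed.

Lemma foldr_minn_le (w : nat) (s : seq nat) (x : nat) : x \in w :: s ->
  foldr minn w s <= x.
Proof.
elim: s => [|y s IH] /=; first by rewrite inE => /eqP ->.
rewrite geq_min !inE => /or3P[xw|/eqP ->|xs]; last 1 first.
- by rewrite IH ?orbT // inE xs orbT.
- by rewrite IH ?orbT // inE xw.
- by rewrite leqnn.
Qed.

Lemma lightest_le E u v (w : nat) :
  ((u, v, w) \in E) || ((v, u, w) \in E) -> lightest E u v <= w.
Proof.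
move=> uvE; have: w \in edge_weights E u v.
  apply/mapP; case/orP: uvE => uvE; [exists (u, v, w)|exists (v, u, w)] => //;
    by rewrite mem_filter uvE eqxx ?orbT.
by rewrite /lightest; case: edge_weights => [//|x s]; apply: foldr_minn_le.
Qed.

Lemma lightest_mem E u v : lightest E u v != 0 ->
  exists w : nat, lightest E u v = w /\ (((u, v, w) \in E) || ((v, u, w) \in E)).
Proof.
rewrite /lightest; case wsE: (edge_weights E u v) => [//|x s] _.
have := foldr_minn_mem x s; set w := foldr _ _ _; rewrite -wsE => /mapP[[e1 e2]].
rewrite mem_filter /= => /andP[/orP[] /eqP -> eE] ->; exists e2; split=> //;
  by rewrite eE ?orbT.
Qed.

Definition sound (d : 'I_n -> 'I_n -> nat) E :=
  forall u v (w : nat), (u, v, w) \in E -> d u v <= w.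

Lemma sound_cat d E1 E2 : sound d E1 -> sound d E2 -> sound d (E1 ++ E2).
Proof. by move=> s1 s2 u v w; rewrite mem_cat => /orP[/s1|/s2]. Qed.

Lemma augmentE G E u v : augment G E u v =
  if hop_wt G E u v != 0 then hop_wt G E u v else G u v.
Proof. by []. Qed.

Section Augment.
Variables (G : wgraph n) (d : 'I_n -> 'I_n -> nat).
Hypothesis dG : is_metric_of G d.

Lemma lightest_ge E u v : sound d E -> lightest E u v != 0 -> d u v <= lightest E u v.
Proof.
move=> sE /lightest_mem[w [-> /orP[/sE//|/sE]]].
by rewrite (gmetric_sym dG).
Qed.

Lemma augment_edge_ge E u v : sound d E -> adj (augment G E) u v ->
  d u v <= augment G E u v.
Proof.
move=> sE; rewrite adjE augmentE; case: ifP => [hw _|_ uv]; last exact: gmetric_edge.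
move: hw; rewrite /hop_wt ffunE; case: ifP => // _; exact: lightest_ge.
Qed.

Lemma augment_walk_ge E a h D u v : sound d E -> walk a (augment G E) h D u v ->
  d u v <= D.
Proof.
move=> sE; elim=> [*|{}h {}D {}u w {}v _ uw _ IH]; first by rewrite (gmetric_refl dG).
apply: leq_trans (gmetric_triangle dG w u v) _.
by apply: leq_add IH; exact: augment_edge_ge.
Qed.

Lemma augment_edge E u v (w : nat) : sound d E -> (u, v, w) \in E ->
  exists2 D, walk predT (augment G E) 1 D u v & D <= w.
Proof.
(* A center kept for the next phase is joined to itself; loops are absent from [hop_graph], and the
   empty walk serves. *)
move=> sE uvE; have [<-|nuv] := eqVneq u v; first by exists 0; [exact: walk_nil|].
have lw : lightest E u v <= w by apply: lightest_le; rewrite uvE.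
(* Weight 0 would be read as a missing edge; soundness bounds each listed weight below by a positive
   distance. *)
have l0 : lightest E u v != 0.
  rewrite /lightest; have: w \in edge_weights E u v.
    by apply/mapP; exists (u, v, w) => //; rewrite mem_filter uvE eqxx.
  case wsE: (edge_weights E u v) => [//|x s] _.
  have := foldr_minn_mem x s; set z := foldr _ _ _; rewrite -wsE => /mapP[[e1 e2]].
  rewrite mem_filter /= => /andP[/orP[] /eqP -> eE] ->; rewrite -lt0n.
    by apply: leq_trans (sE _ _ _ eE); exact: gmetric_gt0 dG _ _ nuv.
  by apply: leq_trans (sE _ _ _ eE); apply: (gmetric_gt0 dG); rewrite eq_sym.
suff [av le] : adj (augment G E) u v /\ augment G E u v <= lightest E u v.
  by exists (augment G E u v); [exact: walk_edge|exact: leq_trans lw].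
rewrite adjE augmentE /hop_wt !ffunE (eq_sym v) (negbTE nuv) /=.
by have [/andP[g0 le]|_] := boolP (_ && _); rewrite ?l0 // eqxx.
Qed.

Lemma augment_base_edge E u v : adj G u v ->
  adj (augment G E) u v /\ augment G E u v <= G u v.
Proof.
rewrite !adjE augmentE /hop_wt !ffunE => uv; rewrite uv /=.
have [_|] := boolP (_ || _); first by rewrite eqxx.
rewrite negb_or -ltnNge => /andP[_ lt].
by case: ifP => [l0|_]; rewrite ?l0; split=> //; apply: ltnW.
Qed.

(** Listing more edges can only lower the weights, since [augment] retains the lighter of the listed
    and the original edge. *)
Lemma augment_sub E E' a h D u v : sound d E' -> {subset E <= E'} ->
  walk a (augment G E) h D u v ->
  exists2 D', walk predT (augment G E') h D' u v & D' <= D.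
Proof.
move=> sE' EE'; elim=> [*|{}h {}D {}u w {}v _ uw _ [D' wk D'D]].
  by exists 0 => //; apply: walk_nil.
suff [D1 w1 le1] : exists2 D1, walk predT (augment G E') 1 D1 u w &
  D1 <= augment G E u w.
  by exists (D1 + D'); [rewrite -add1n; exact: walk_cat wk|exact: leq_add].
move: uw; rewrite adjE augmentE /hop_wt !ffunE; case: ifP => [|_ uw].
  case: ifP => // _ /lightest_mem[z [-> /orP[]/EE' zE]] _.
    exact: augment_edge.
  have [D1 /walk_sym ? ?] := augment_edge sE' zE; by exists D1.
have [av le] := augment_base_edge E' uw.
by exists (augment G E' u w) => //; apply: walk_edge.
Qed.

End Augment.

Lemma num_edges_hop_graph G E : num_edges (hop_graph G E) <= size E.
Proof.
pose f (e : edge) : 'I_n * 'I_n := if e.1.1 < e.1.2 then e.1 else (e.1.2, e.1.1).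
rewrite /num_edges -(size_map f); apply: leq_trans (card_size _).
apply/subset_leq_card/subsetP => -[u v]; rewrite inE adjE /= /hop_wt ffunE => /andP[uv].
case: ifP => // _ /lightest_mem[w [_ /orP[]uvE]]; apply/mapP.
  by exists (u, v, w); rewrite // /f /= uv.
by exists (v, u, w); rewrite // /f /= ltnNge (ltnW uv).
Qed.

End Walks.

(** * Broadcast protocols *)

Section Programs.
Variables (n : nat) (Msg View : Type).

(* A deterministic protocol in which all messages are broadcast.  What a
   processor sends depends on its own input; the continuation is public. *)
Inductive prog (Y : Type) : Type :=
| Ret of Y
| Round of ('I_n -> View -> Msg) & ({ffun 'I_n -> Msg} -> prog Y).

Fixpoint bind (Y Z : Type) (p : prog Y) (f : Y -> prog Z) : prog Z :=
  match p with
  | Ret y => f y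
  | Round m k => Round m (fun r => bind (k r) f)
  end.

Variable g : 'I_n -> View.

Fixpoint result (Y : Type) (p : prog Y) : Y :=
  match p with
  | Ret y => y
  | Round m k => result (k [ffun v => m v (g v)])
  end.

Fixpoint rounds (Y : Type) (p : prog Y) : nat :=
  match p with
  | Ret _ => 0
  | Round m k => (rounds (k [ffun v => m v (g v)])).+1
  end.

Definition yields (Y : Type) (p : prog Y) (r : nat) (Q : Y -> Prop) : Prop :=
  rounds p <= r /\ Q (result p).

Lemma result_bind (Y Z : Type) (p : prog Y) (f : Y -> prog Z) :
  result (bind p f) = result (f (result p)).
Proof. by elim: p => //= m k IH; rewrite IH. Qed.

Lemma rounds_bind (Y Z : Type) (p : prog Y) (f : Y -> prog Z) :
  rounds (bind p f) = rounds p + rounds (f (result p)).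
Proof. by elim: p => //= m k IH; rewrite IH. Qed.

Lemma yields_bind (Y Z : Type) (p : prog Y) (f : Y -> prog Z) r1 r2 Q1 Q2 :
  yields p r1 Q1 -> (forall y, Q1 y -> yields (f y) r2 Q2) ->
  yields (bind p f) (r1 + r2) Q2.
Proof.
case=> le1 q1 /(_ _ q1)[le2 q2]; split; last by rewrite result_bind.
by rewrite rounds_bind leq_add.
Qed.

Fixpoint repeat (Y : Type) (k : nat) (f : Y -> prog Y) (y : Y) : prog Y :=
  if k is k'.+1 then bind (repeat k' f y) f else Ret y.

Lemma yields_repeat (Y : Type) (f : Y -> prog Y) r (Q : nat -> Y -> Prop) k y :
  Q 0 y -> (forall j z, j < k -> Q j z -> yields (f z) r (Q j.+1)) ->
  yields (repeat k f y) (k * r) (Q k).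
Proof.
move=> Q0; elim: k => [|k IH] step; first by split.
rewrite mulSnr; apply: yields_bind (IH _) _ => [j z jk|z]; first by apply: step; lia.
exact: step.
Qed.

End Programs.

Section Broadcast.
Variables n W : nat.
Local Notation view := {ffun 'I_n -> nat}.
Local Notation item := ('I_n * nat)%type.
Local Notation msg := (message n W 3).
Local Notation program := (prog n msg view).

(* The number d is sent in base W + 1, with a vertex identity as its leading
   digit: correct for d < n (W + 1). *)
Definition encode (l : seq item) : msg :=
  if l is (y, d) :: _ then
    [bseq inl y; inl (insubd y (d %/ W.+1)); inr (inord (d %% W.+1))]
  else [bseq].

Definition decode (m : msg) : seq item :=
  match bseqval m with
  | [:: inl y; inl q; inr r] => [:: (y, q * W.+1 + r)]
  | _ => [::]
  end.

Lemma encodeK l : all (fun p => p.2 < n * W.+1) l -> decode (encode l) = take 1 l.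
Proof.
case: l => [|[y d] l] //= /andP[dn _]; rewrite take0 /decode /=.
rewrite val_insubd ltn_divLR // dn inordK ?ltn_pmod //.
by rewrite -divn_eq.
Qed.

Fixpoint broadcast (s : nat) (f : 'I_n -> view -> seq item) :
    program ('I_n -> seq item) :=
  if s is s'.+1 then
    Round (fun v g => encode (f v g)) (fun m =>
      bind (broadcast s' (fun v g => behead (f v g))) (fun r =>
        Ret _ _ _ (fun v => decode (m v) ++ r v)))
  else Ret _ _ _ (fun=> [::]).

Lemma yields_broadcast (g : 'I_n -> view) s f :
  (forall v, all (fun p => p.2 < n * W.+1) (f v (g v))) ->
  (forall v, size (f v (g v)) <= s) ->
  yields g (broadcast s f) s (fun r => forall v, r v = f v (g v)).
Proof.
elim: s f => [|s IH] f fb fs.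
  by split=> //= v; move: (fs v); case: (f v (g v)).
rewrite /= /yields /= -/(yields _ _ _ _); split.
  rewrite ltnS rounds_bind /= addn0; apply: (IH _ _ _).1 => v; last first.
    by rewrite size_behead; have := fs v; lia.
  by have := fb v; case: (f v (g v)) => //= a l /andP[].
move=> v; rewrite result_bind /= ffunE encodeK // (IH _ _ _).2 => [|u|u].
- by case: (f v (g v)) => //= a l; rewrite take0.
- by have := fb u; case: (f u (g u)) => //= a l /andP[].
- by rewrite size_behead; have := fs u; lia.
Qed.

(** * Broadcast protocols as Congested Clique algorithms *)

Section Simulation.
Variables (Y : Type) (p : program Y) (out : Y -> 'I_n -> view -> view).

Definition alg_state : Type := (program Y * ('I_n * view))%type.

(** There are no random bits. Since a processor also receives its own message, all processors hold
    the same residual program at all times and halt together. *)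
Definition alg_of : cc_alg n W 3 :=
  @CCAlg n W 3 0 alg_state
    (fun v g _ => (p, (v, g)))
    (fun v s _ => if s.1 is Round m _ then m v s.2.2 else [bseq])
    (fun v s r => if s.1 is Round _ k then (k r, s.2) else s)
    (fun s => if s.1 is Ret y then Some (out y s.2.1 s.2.2) else None).

Lemma computes_alg_of (G : wgraph n) (w : coins alg_of) H :
  (forall v, local_view H v = out (result (local_view G) p) v (local_view G v)) ->
  computes_in G w (rounds (local_view G) p) H.
Proof.
move=> HE v; rewrite /cc_run.
have -> : (fun v0 => cc_init v0 (local_view G v0) (w v0)) =
  (fun u => (p, (u, local_view G u)) : alg_state) by [].
suff E q : iter (rounds (local_view G) q) (@cc_step n W 3 alg_of)
    (fun u => (q, (u, local_view G u))) =
    (fun u => (Ret _ _ _ (result (local_view G) q), (u, local_view G u))).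
  by rewrite E /= HE.
elim: q => [//|m k IH]; rewrite iterSr /= -IH; congr (iter _ _ _).
Qed.

End Simulation.
End Broadcast.

(** * Filtered Bellman-Ford exploration *)

Lemma take_sortP (T : eqType) (f : T -> nat) (l : seq T) (s : nat)
    (r := take s (sort (fun x y => f x <= f y) l)) (z : T) : z \in l ->
  z \in r \/ size r = s /\ forall y, y \in r -> f y <= f z.
Proof.
have tot : total (fun x y : T => f x <= f y) by move=> x y; exact: leq_total.
have tr : transitive (fun x y : T => f x <= f y) by move=> y x u; exact: leq_trans.
set l' := sort _ l in r *; have -> : (z \in l) = (z \in l') by rewrite mem_sort.
have : sorted (fun x y => f x <= f y) l' by exact: sort_sorted.
rewrite sorted_pairwise // -(cat_take_drop s l') pairwise_cat mem_cat -/r.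
case/and3P=> /allrelP le _ _ /orP[->|zd]; [by left|right]; split; last first.
  by move=> y yr; apply: le.
by rewrite size_take; case: ltnP => // sl; rewrite drop_oversize in zd.
Qed.

Section BellmanFord.
Variables n W : nat.
Local Notation view := {ffun 'I_n -> nat}.
Local Notation item := ('I_n * nat)%type.
Local Notation table := ('I_n -> seq item).
Variables (E : seq (edge n)) (P : {set 'I_n}) (th s : nat).

Definition augment_row (v : 'I_n) (g : view) (u : 'I_n) : nat :=
  if hop_row E v g u != 0 then hop_row E v g u else g u.

Lemma augment_rowE (G : wgraph n) v u :
  augment_row v (local_view G v) u = augment G E v u.
Proof. by rewrite /augment_row augmentE /hop_wt (ffunE (fun u => G v u)). Qed.

Definition offers (T : table) v (g : view) (z : 'I_n) (e : nat) : bool :=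
  [exists w, has (fun p => (p.1 == z) &&
     ((w == v) && (p.2 == e)
      || (augment_row v g w != 0) && (augment_row v g w + p.2 == e))) (T w)].

(* The value th + 1 means that no offer is at most th. *)
Definition closest (T : table) v (g : view) (z : 'I_n) : nat :=
  find (offers T v g z) (iota 0 th.+1).

Definition relax (T : table) v (g : view) : seq item :=
  [seq (z, closest T v g z) | z <- take s (sort
     (fun x y => closest T v g x <= closest T v g y)
     [seq z <- enum P | closest T v g z <= th])].

Definition init_table (v : 'I_n) : seq item :=
  if v \in P then [:: (v, 0)] else [::].

Lemma closest_le T v g z e : offers T v g z e -> e <= th -> closest T v g z <= e.
Proof.
move=> oe eth; rewrite leqNgt; apply/negP => /(before_find 0).
by rewrite nth_iota // add0n oe.
Qed.

Lemma closest_offers T v g z : closest T v g z <= th ->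
  offers T v g z (closest T v g z).
Proof.
move=> le; have lt : closest T v g z < size (iota 0 th.+1) by rewrite size_iota.
by have := nth_find 0; move/(_ (offers T v g z) (iota 0 th.+1));
  rewrite nth_iota ?add0n; [apply; rewrite has_find|].
Qed.

Variables (G : wgraph n) (d : 'I_n -> 'I_n -> nat).
Hypotheses (dG : is_metric_of G d) (sE : sound d E).

(** The last clause survives truncation: a center within [D] may be missing only from a full list
    whose estimates are all at most [D]. *)
Definition table_ok (h : nat) (v : 'I_n) (L : seq item) : Prop :=
  [/\ uniq (map fst L), size L <= s,
    forall y e, (y, e) \in L -> [/\ y \in P, e <= th & d v y <= e] &
    forall y D, y \in P -> walk predT (augment G E) h D v y -> D <= th ->
      (exists2 e, (y, e) \in L & e <= D) \/
      size L = s /\ forall z e, (z, e) \in L -> e <= D].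

Lemma init_table_ok v : 0 < s -> table_ok 0 v (init_table v).
Proof.
move=> s0; rewrite /init_table; split.
- by case: ifP.
- by case: ifP.
- move=> y e; case: ifP => // vP; rewrite inE => /eqP[-> ->].
  by rewrite vP (gmetric_refl dG).
- move=> y D yP /walk_inv[[vy ->] _|[h' [w [D' []//]]]].
  by left; exists 0; rewrite // vy yP mem_head.
Qed.

Lemma relax_ok T h v : (forall w, table_ok h w (T w)) ->
  table_ok h.+1 v (relax T v (local_view G v)).
Proof.
move=> ok; set f := closest T v (local_view G v).
set l := [seq z <- enum P | f z <= th].
set r := take s (sort (fun x y => f x <= f y) l).
have rE : relax T v (local_view G v) = [seq (z, f z) | z <- r] by [].
have rl : {subset r <= l} by move=> z /mem_take; rewrite mem_sort.
have rs : size r <= s by rewrite size_take; case: ltnP.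
have ur : uniq r by rewrite take_uniq // sort_uniq filter_uniq // enum_uniq.
have inl z : z \in P -> f z <= th -> z \in l by rewrite mem_filter mem_enum => -> ->.
have memL z e : (z, e) \in relax T v (local_view G v) -> z \in r /\ e = f z.
  by rewrite rE => /mapP[x xr [-> ->]].
split.
- by rewrite rE -map_comp map_id.
- by rewrite rE size_map.
- move=> y e /memL[/rl yl ->]; move: yl.
  rewrite mem_filter mem_enum => /andP[fy yP]; split=> //.
  have /existsP[w /hasP[[z e'] zT /= /andP[/eqP zy]]] := closest_offers fy.
  rewrite -/(f y); have [_ _ /(_ _ _ zT)[_ _ le] _] := ok w; rewrite zy in le.
  case/orP=> /andP[]; first by move=> /eqP wv /eqP <-; rewrite -wv.
  rewrite augment_rowE => vw /eqP <-.
  apply: leq_trans (gmetric_triangle dG w v y) _; apply: leq_add le.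
  exact: augment_edge_ge.
move=> y D yP wk Dth.
(* Before truncation, either [y] itself is offered within [D], or [s] distinct centers are, all
   coming from a single full list. *)
suff [fy|[Z [uZ sZ ZP]]] : f y <= D \/
    exists Z, [/\ uniq Z, size Z = s & forall z, z \in Z -> z \in P /\ f z <= D].
- have [yr|[sr le]] := take_sortP f s (inl _ yP (leq_trans fy Dth)).
    by left; exists (f y) => //; rewrite rE; apply/mapP; exists y.
  right; rewrite rE size_map; split=> // z e /memL[zr ->].
  exact: leq_trans (le _ zr) fy.
- have Zl z : z \in Z -> z \in l.
    by move=> /ZP[zP fz]; apply: inl => //; apply: leq_trans Dth.
  right; have sr : size r = s.
    rewrite size_take size_sort; have := uniq_leq_size uZ Zl; rewrite sZ.
    by rewrite leq_eqVlt => /orP[/eqP <-|->] //; rewrite ltnn.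
  (* If a kept [x] had an estimate above [D], every member of [Z] would be kept as well; both sets
     have [s] elements, so [x] would lie in [Z]. *)
  rewrite rE size_map; split=> // x e /memL[xr ->]; rewrite leqNgt; apply/negP => Dx.
  have Zr z : z \in Z -> z \in r.
    move=> zZ; have [//|[_ /(_ _ xr) le]] := take_sortP f s (Zl _ zZ).
    by have [_ ?] := ZP _ zZ; have := leq_trans le (_ : f z <= D); lia.
  have [|_ Zr2] := uniq_min_size uZ Zr; first by rewrite sr sZ.
  by move: xr; rewrite -Zr2 => /ZP[_]; lia.
(* The case [w = v] with cost 0 covers the empty walk, for which [v] keeps its own entries. *)
have step w c D' : (w = v /\ c = 0) \/ (adj (augment G E) v w /\ c = augment G E v w) ->
    walk predT (augment G E) h D' w y -> D = c + D' ->
    f y <= D \/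
    exists Z, [/\ uniq Z, size Z = s & forall z, z \in Z -> z \in P /\ f z <= D].
  move=> link wk' DE.
  have fle z e : (z, e) \in T w -> e <= D' -> f z <= D.
    move=> zT eD; apply: (@leq_trans (c + e)); last by lia.
    apply: closest_le; last by lia.
    apply/existsP; exists w; apply/hasP; exists (z, e) => //=; rewrite eqxx /=.
    case: link => [[-> ->]|[vw ->]]; first by rewrite !eqxx.
    by rewrite augment_rowE eqxx -adjE vw orbT.
  have [uT sT memT compl] := ok w.
  case: (compl y D' yP wk') => [|[e yT le]|[sTs le]]; first by lia.
    by left; apply: fle yT le.
  right; exists (map fst (T w)); rewrite size_map; split=> // z /mapP[[z' e] zT ->].
  by have [? _ _] := memT _ _ zT; split=> //; apply: fle zT (le _ _ zT).
case/walk_inv: wk => [[vy D0]|[h' [w [D' [[<-] vw wk DE]]]]].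
  by apply: (step v 0 0); rewrite ?D0 //; [left|rewrite vy; apply: walk_nil].
by apply: (step w _ D' _ wk DE); right.
Qed.

Definition bellman_ford (B : nat) : prog n (message n W 3) view table :=
  repeat B (fun T => broadcast W s (relax T)) init_table.

Lemma yields_bellman_ford B : 0 < s -> th < n * W.+1 ->
  yields (local_view G) (bellman_ford B) (B * s) (fun T => forall v,
    table_ok B v (T v)).
Proof.
move=> s0 thn.
apply: (yields_repeat (Q := fun h T => forall v, table_ok h v (T v))).
  by move=> v; exact: init_table_ok.
move=> j T _ okT; have ok v := relax_ok v okT.
have := @yields_broadcast n W (local_view G) s (relax T).
case=> [v|v|le res].
- apply/allP => -[y e] ye; have [_ _ /(_ _ _ ye)[_ eth _] _] := ok v.
  exact: leq_ltn_trans thn.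
- by have [_ ? _ _] := ok v.
- by split=> // v; rewrite res.
Qed.

End BellmanFord.

(** * Superclustering phases *)

Lemma size_flatten_le (T U : Type) (f : T -> seq U) (l : seq T) (s : nat) :
  (forall x, size (f x) <= s) -> size (flatten (map f l)) <= size l * s.
Proof.
by move=> fs; elim: l => //= x l IH; rewrite size_cat mulSn leq_add.
Qed.

Lemma card_bigcup_disjoint (T I : finType) (Q : {set I}) (F : I -> {set T}) :
  {in Q &, forall i j, i != j -> [disjoint F i & F j]} ->
  #|\bigcup_(i in Q) F i| = \sum_(i in Q) #|F i|.
Proof.
move=> disj; pose F' i := if i \in Q then F i else set0.
rewrite big_mkcond [RHS]big_mkcond /= -sum1_card.
rewrite partition_disjoint_bigcup => [|i j ij].
  by apply: eq_bigr => i _; rewrite sum1_card; case: ifP; rewrite ?cards0.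
have [iQ|_] := boolP (i \in Q); last by rewrite disjoints_subset sub0set.
have [jQ|_] := boolP (j \in Q); first exact: disj.
by rewrite disjoint_sym disjoints_subset sub0set.
Qed.

Section Phases.
Variables n W : nat.
Local Notation view := {ffun 'I_n -> nat}.
Local Notation item := ('I_n * nat)%type.
Local Notation table := ('I_n -> seq item).
Local Notation program := (prog n (message n W 3) view).

Section OnePhase.
Variables (P : {set 'I_n}) (s : nat) (T : table).

Definition names (L : seq item) : {set 'I_n} := [set z in map fst L].

Definition popular (x : 'I_n) : bool := (x \in P) && (s <= size (T x)).

Definition scattered (Q : {set 'I_n}) : bool :=
  [forall x in Q, popular x] &&
  [forall x in Q, forall y in Q,
    (x != y) ==> [disjoint names (T x) & names (T y)]].

(** A largest scattered family is maximal for inclusion, as [next_meets] requires. It depends on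
    broadcast data only, so all processors find the same one. *)
Definition next_centers : {set 'I_n} :=
  [arg max_(Q > set0 | scattered Q) #|Q|].

Definition joins (x : 'I_n) : seq (edge n) :=
  [seq (x, c.2.1, c.1.2 + c.2.2.2) | c <-
    [seq c <- [seq (p, qp) | p <- T x,
                 qp <- [seq (q, p) | q <- enum next_centers, p <- T q]]
     | c.1.1 == c.2.2.1]].

Definition phase_edges : seq (edge n) :=
  flatten [seq if popular x then take 1 (joins x) else [seq (x, p.1, p.2) | p <- T x]
          | x <- enum P].

Lemma scattered0 : scattered set0.
Proof. by apply/andP; split; apply/forallP => x; rewrite in_set0. Qed.

Lemma scattered_next : scattered next_centers.
Proof. by rewrite /next_centers; case: arg_maxnP => //; exact: scattered0. Qed.

Lemma next_popular x : x \in next_centers -> popular x.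
Proof. by have /andP[/forall_inP + _] := scattered_next; apply. Qed.

(** Otherwise adding [x] would give a larger scattered set. A chosen [x] meets itself, its list
    being nonempty. *)
Lemma next_meets x : 0 < s -> popular x ->
  exists2 q, q \in next_centers & ~~ [disjoint names (T x) & names (T q)].
Proof.
move=> s0 px; have [xQ|xQ] := boolP (x \in next_centers).
  exists x => //; case/andP: px => _; case Tx: (T x) => [|p L] //=; first by lia.
  move=> _; apply/negP => /disjointFr/(_ (_ : p.1 \in _)).
  by rewrite inE /= mem_head => /(_ isT).
case: (boolP [exists q in next_centers, ~~ [disjoint names (T x) & names (T q)]]).
  by case/exists_inP => q; exists q.
rewrite negb_exists_in => /forall_inP far.
have : scattered (x |: next_centers).
  have /andP[/forall_inP pop /forall_inP disj] := scattered_next.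
  apply/andP; split; first by apply/forall_inP => y /setU1P[->//|/pop].
  apply/forall_inP => y /setU1P[->|yQ]; apply/forall_inP => z /setU1P[->|zQ].
  - by rewrite eqxx.
  - by apply/implyP => _; apply/negPn/far.
  - by apply/implyP => _; rewrite disjoint_sym; apply/negPn/far.
  - by move/forall_inP: (disj _ yQ); apply.
move: xQ; rewrite /next_centers; case: arg_maxnP; first exact: scattered0.
by move=> Q _ max xQ /max; rewrite cardsU1 xQ /= add1n ltnn.
Qed.

Lemma joinsP x q w : (x, q, w) \in joins x ->
  exists z e1 e2, [/\ q \in next_centers, (z, e1) \in T x, (z, e2) \in T q &
    w = e1 + e2].
Proof.
case/mapP=> -[[z e1] [q' [z' e2]]]; rewrite mem_filter /= => /andP[/eqP zz].
case/allpairsP=> -[p qp] /= [pT /allpairsPdep[q3 [p3 [q3N p3T ->]]] eq].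
case: eq zz pT p3T => <- -> <- /= <- pT p3T [-> ->]; exists z, e1, e2.
by rewrite -mem_enum q3N.
Qed.

Lemma joins_neq0 x : 0 < s -> popular x -> joins x != [::].
Proof.
move=> s0 px; have [q qN] := next_meets s0 px.
rewrite -setI_eq0 => /set0Pn[z]; rewrite !inE => /andP[/mapP[p pT ->] /mapP[p' p'T pp]].
suff : (x, q, p.2 + p'.2) \in joins x by case: (joins x).
apply/mapP; exists (p, (q, p')) => //; rewrite mem_filter /= pp eqxx.
apply/allpairsP; exists (p, (q, p')); split=> //.
by apply/allpairsPdep; exists q, p'; rewrite mem_enum.
Qed.

End OnePhase.

Variables (G : wgraph n) (d : 'I_n -> 'I_n -> nat) (E0 : seq (edge n)) (B : nat).
Hypotheses (dG : is_metric_of G d) (sE0 : sound d E0).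

(** The pair [ts] consists of the exploration threshold and the list size. A superclustering edge
    passes through a common list entry, whence twice the threshold. *)
Definition phase_ok (ts : nat * nat) (P Q : {set 'I_n}) (E : seq (edge n)) : Prop :=
  #|Q| * ts.2 <= #|P| /\
  forall x, x \in P ->
    (exists q w, [/\ q \in Q, w <= ts.1.*2 & (x, q, w) \in E]) \/
    forall y D, y \in P -> walk predT (augment G E0) B D x y -> D <= ts.1 ->
      exists2 e, (x, y, e) \in E & e <= D.

Lemma phase_ok_sub ts P Q E E' : {subset E <= E'} ->
  phase_ok ts P Q E -> phase_ok ts P Q E'.
Proof.
move=> EE' [card ok]; split=> // x /ok[[q [w [qQ wt /EE' xE]]]|un]; [left|right].
  by exists q, w.
by move=> y D yP wk Dt; have [e /EE' eE eD] := un y D yP wk Dt; exists e.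
Qed.

Section PhaseProof.
Variables (P : {set 'I_n}) (th s : nat) (T : table).
Hypotheses (s0 : 0 < s) (okT : forall x, table_ok E0 P th s G d B x (T x)).

Lemma table_sound x y e : (y, e) \in T x -> e <= th /\ d x y <= e.
Proof. by have [_ _ /(_ y e) + _] := okT x => /[apply] -[]. Qed.

Lemma phase_edges_sound : sound d (phase_edges P s T).
Proof.
move=> u v w /flattenP[l /mapP[x xP ->]]; case: ifP => _; last first.
  by case/mapP=> -[y e] yT [-> -> ->]; case: (table_sound yT).
move=> /mem_take uvE; have xu : u = x by case/mapP: uvE => ? _ [].
rewrite xu in uvE *; have [z [e1 [e2 [_ /table_sound[_ le1] /table_sound[_ le2]
  ->]]]] := joinsP uvE.
apply: leq_trans (gmetric_triangle dG z x v) (leq_add le1 _).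
by rewrite (gmetric_sym dG).
Qed.

Lemma size_phase_edges : size (phase_edges P s T) <= #|P| * s.
Proof.
rewrite cardE; apply: size_flatten_le => x; case: ifP => _.
  by rewrite size_take; case: ltnP => // le; lia.
by rewrite size_map; have [] := okT x.
Qed.

(** The lists of the kept centers are disjoint subsets of [P] with [s] elements each, which gives
    the cardinality bound. The list of an unpopular center is not full, so by [table_ok] it misses
    nothing within the threshold. *)
Lemma phase_edges_ok : phase_ok (th, s) P (next_centers P s T) (phase_edges P s T).
Proof.
split=> [|x xP] /=.
  have card x : x \in next_centers P s T -> #|names (T x)| = s.
    move=> /next_popular/andP[_ le]; have [uT ge _ _] := okT x.
    by rewrite cardsE (card_uniqP uT) size_map; apply/eqP; rewrite eqn_leq ge.
  have /andP[_ /forall_inP disj] := scattered_next P s T.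
  rewrite -sum_nat_const -(eq_bigr _ card) -card_bigcup_disjoint => [|y z yQ zQ].
    apply/subset_leq_card/bigcupsP => y yQ; apply/subsetP => z.
    rewrite inE => /mapP[[z' e] zT ->]; have [_ _ mem _] := okT y.
    by case: (mem _ _ zT).
  by have /forall_inP/(_ z zQ)/implyP := disj y yQ; apply.
have sub e : e \in (if popular P s T x then take 1 (joins P s T x)
    else [seq (x, p.1, p.2) | p <- T x]) -> e \in phase_edges P s T.
  by move=> ex; apply/flattenP; eexists; last exact: ex; apply: map_f; rewrite mem_enum.
case: ifP sub => px sub; [left|right].
  case jE: (joins P s T x) (joins_neq0 s0 px) => [//|[[u q] w] l] _.
  have : (u, q, w) \in joins P s T x by rewrite jE mem_head.
  move=> uqJ; have xu : u = x by case/mapP: uqJ => ? _ [].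
  rewrite {}xu in jE uqJ; exists q, w.
  have [z [e1 [e2 [qN /table_sound[le1 _] /table_sound[le2 _] wE]]]] := joinsP uqJ.
  split=> //; first by rewrite wE -addnn leq_add.
  by apply: sub; rewrite jE /= take0 mem_head.
move=> y D yP wk Dth; have [_ _ _ compl] := okT x.
case: (compl y D yP wk Dth) => [[e yT eD]|[sT _]].
  by exists e => //; apply: sub; apply/mapP; exists (y, e).
by move: px; rewrite /popular xP sT leqnn.
Qed.

End PhaseProof.

Fixpoint phases (ts : seq (nat * nat)) (P : {set 'I_n}) : program (seq (edge n)) :=
  if ts is (th, s) :: ts' then
    bind (bellman_ford W E0 P th s B) (fun T =>
      bind (phases ts' (next_centers P s T)) (fun E =>
        Ret _ _ _ (phase_edges P s T ++ E)))
  else Ret _ _ _ [::].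

Definition phases_ok (ts : seq (nat * nat)) (P : {set 'I_n}) (E : seq (edge n)) :
  Prop :=
  sound d E /\
  exists Ps : nat -> {set 'I_n}, [/\ Ps 0 = P,
    size E <= \sum_(i < size ts) #|Ps i| * (nth (0, 0) ts i).2 &
    forall i, i < size ts -> phase_ok (nth (0, 0) ts i) (Ps i) (Ps i.+1) E].

Lemma yields_phases (m : nat) ts P :
  all (fun t => [&& 0 < t.2, t.2 <= m & t.1 < n * W.+1]) ts ->
  yields (local_view G) (phases ts P) (size ts * (B * m)) (phases_ok ts P).
Proof.
elim: ts P => [|[th s] ts IH] P /=.
  by move=> _; split=> //; split=> //; exists (fun=> P); split.
case/andP=> /and3P[/= s0 sm thn] /IH{}IH; rewrite mulSn.
have := yields_bellman_ford P dG sE0 B s0 thn; case=> le okT.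
split; rewrite ?rounds_bind ?result_bind /=.
  rewrite addn0 leq_add //; first by apply: leq_trans le _; rewrite leq_mul.
  by have [] := IH (next_centers P s (result (local_view G) (bellman_ford W E0 P th s
    B))).
set T := result _ _ in okT *.
have [_ [sE [Ps [Ps0 szE okE]]]] := IH (next_centers P s T);
  set E := result _ _ in sE szE okE *.
split; first by apply: sound_cat => //; exact: phase_edges_sound okT.
exists (fun i => if i is i'.+1 then Ps i' else P); split=> //.
  by rewrite size_cat big_ord_recl leq_add //=; apply: size_phase_edges okT.
move=> [_|i /okE]; last by apply: phase_ok_sub => e eE; rewrite mem_cat eE orbT.
rewrite Ps0; apply: phase_ok_sub (phase_edges_ok s0 okT) => e eE.
by rewrite mem_cat eE.
Qed.

End Phases.

(** * Stretch of a single-scale hopset *)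

Section Numbers.
Variables r M l : nat.

Definition seg i := r %/ M ^ (l - i).

(* Unfolding of rad i + 4 * reachd i: a superclustering edge is at most twice
   as long as the exploration threshold 2 * reachd i. *)
Fixpoint rad i := if i is i'.+1 then 9 * rad i' + 4 * seg i' else 0.

(** A bound on the distance between the centers of two superclusters of radius [rad i] that contain
    vertices at distance at most [seg i]. *)
Definition reachd i := seg i + 2 * rad i.

(** A path of level [i' + 1] leaves at most [M + 1] pieces of level [i'], each with one more edge,
    and a bridge of [2 * (i' + 1) + 1] edges. In [err], each piece costs [err i'] and the bridge six
    radii. *)
Fixpoint hops i := if i is i'.+1 then M.+1 * (hops i').+1 + (2 * i' + 3) else 1.

Fixpoint err i := if i is i'.+1 then M.+1 * err i' + 6 * rad i'.+1 else 0.

Lemma hops_gt i : i < hops i.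
Proof. by elim: i => //= i; rewrite mulnS mulSn; lia. Qed.

Lemma seg_top : seg l = r.
Proof. by rewrite /seg subnn divn1. Qed.

Lemma seg_le i : seg i <= r. Proof. exact: leq_div. Qed.

Hypothesis M18 : 18 <= M.

Lemma segS i : i < l -> seg i.+1 < M * (seg i).+1.
Proof.
move=> il; rewrite /seg -[l - i](@ltn_predK 0) ?subn_gt0 // -subnS expnSr divnMA.
by rewrite mulnC ltn_ceil //; lia.
Qed.

(** The constant 8 reproduces itself: as [18 <= M], the term [9 * rad i] takes at most half of the
    bound, and [4 * seg i] the other half. *)
Lemma rad_le i : i <= l -> rad i * (M ^ (l - i) * M) <= 8 * r.
Proof.
elim: i => [//|i IH] il; have := IH (ltnW il).
have -> : M ^ (l - i.+1) * M = M ^ (l - i) by rewrite -expnSr; congr (_ ^ _); lia.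
have : seg i * M ^ (l - i) <= r by exact: leq_divM.
rewrite /=; set x := M ^ (l - i); set y := seg i; set z := rad i => yx zx.
have : z * (x * 18) <= z * (x * M) by rewrite !leq_mul2l M18 !orbT.
by move: (z * (x * M)) zx; nia.
Qed.

Lemma reachd_le i : i <= l -> reachd i <= 2 * r.
Proof.
move=> il; have := rad_le il; have := seg_le i; rewrite /reachd.
have : 18 <= M ^ (l - i) * M.
  by rewrite -expnSr; apply: leq_trans M18 _; rewrite -[X in X <= _]expn1 leq_pexp2l
    //; lia.
by move: (M ^ _ * M) => x; move: (seg i) (rad i); nia.
Qed.

Lemma hops_le i : hops i <= (3 * M) ^ i.
Proof.
elim: i => //= i IH; rewrite expnS; have := hops_gt i.
have : 3 * M * hops i <= 3 * M * (3 * M) ^ i by rewrite leq_mul2l IH orbT.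
by move: (_ ^ i) (hops i) => x y; nia.
Qed.

Hypothesis Ml : 2 * l <= M.

(** After scaling, each level adds [48 * r] for the six radii, by [rad_le], and at most [48 * r] for
    the extra piece in [M + 1], because [2 * i <= M]. *)
Lemma err_le i : i <= l -> err i * (M ^ (l - i) * M) <= 96 * i * r.
Proof.
elim: i => [//|i IH] il; have e0 := IH (ltnW il); have := rad_le il.
have -> : M ^ (l - i.+1) * M = M ^ (l - i) by rewrite -expnSr; congr (_ ^ _); lia.
rewrite [err i.+1]/=; move: e0; set x := M ^ (l - i); set e := err i.
set z := rad i.+1 => ex zx.
have ex' : e * x <= 48 * r.
  case: (i =P 0) => [i0|/eqP i0]; first by rewrite /e i0.
  have : e * x * (2 * i) <= e * (x * M) by rewrite -mulnA !leq_mul2l (_ : 2 * i <= M)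
    ?orbT //; lia.
  by move=> le; rewrite -(leq_pmul2r (_ : 0 < 2 * i)); nia.
have -> : (M.+1 * e + 6 * z) * x = e * (x * M) + e * x + 6 * (z * x) by ring.
by nia.
Qed.

End Numbers.

(** * Paths through stopped superclusters *)

Section Stretch.
Variables (R : realType) (n : nat) (G : wgraph n) (d : 'I_n -> 'I_n -> nat).
Hypothesis dG : is_metric_of G d.

Section Segments.
Variables (E : seq (edge n)) (a : pred 'I_n) (h h' L : nat) (k c : R).
Hypotheses (k1 : (1 <= k)%R) (c0 : (0 <= c)%R).
Hypothesis short : forall D u v, walk a G h D u v -> D <= L ->
  exists2 D', walk predT (augment G E) h' D' u v & (D'%:R <= k * D%:R + c :> R)%R.

(** Each greedy piece has length at most [L] and uses at least [L + 1] together with the edge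
    leaving it. The connecting edges, at most [q] of them, are kept as single hops. *)
Lemma walk_segments q D u v : walk a G h D u v -> D < q.+1 * L.+1 ->
  exists2 D', walk predT (augment G E) (q.+1 * h' + q) D' u v &
    (D'%:R <= k * D%:R + q.+1%:R * c :> R)%R.
Proof.
elim: q D u v => [|q IH] D u v wk DL.
  have [|D' wk' le] := short wk; first by lia.
  by exists D'; rewrite ?mul1r // mul1n addn0.
have [DL'|[x [y [D1 [D2 [w1 D1L xy Lxy [w2 DE]]]]]]] := walk_greedy L wk.
  have [D' wk' le] := short wk DL'; exists D'; last first.
    by apply: le_trans le _; rewrite lerD2l ler_peMl // ler1n.
  by apply: walk_weaken wk' => //; rewrite !mulSn; lia.
have [D1' w1' le1] := short w1 D1L.
have [|D2' w2' le2] := IH _ _ _ w2; first by move: DL; rewrite [q.+2 * _]mulSn; lia.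
have [av le] := augment_base_edge E xy.
exists (D1' + (augment G E x y + D2')).
  have -> : q.+2 * h' + q.+1 = h' + (1 + (q.+1 * h' + q)) by rewrite [q.+2 * _]mulSn;
    lia.
  by apply: walk_cat w1' _; apply: walk_cons.
have le' : ((augment G E x y)%:R <= k * (G x y)%:R)%R.
  by apply: (@le_trans _ _ (G x y)%:R%R); rewrite ?ler_nat // ler_peMl.
rewrite DE !natrD -(natr1 q.+1); move: le1 le2 le'; lra.
Qed.

Lemma pre_segments q D u x : pre a G h D u x -> D < q.+1 * L.+1 ->
  exists2 D', walk predT (augment G E) (q.+1 * h'.+1) D' u x &
    (D'%:R <= k * D%:R + q.+1%:R * c :> R)%R.
Proof.
case=> [[-> ->] _|[w [D1 [wk wx ->]]] DL].
  by exists 0; [exact: walk_nil|rewrite mulr0 add0r mulr_ge0].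
have [|D1' w1 le1] := walk_segments (q := q) wk; first by lia.
have [av le] := augment_base_edge E wx.
exists (D1' + augment G E w x).
  have -> : q.+1 * h'.+1 = (q.+1 * h' + q) + 1 by rewrite mulnS; lia.
  by apply: walk_cat w1 _; apply: walk_edge.
have le' : ((augment G E w x)%:R <= k * (G w x)%:R)%R.
  by apply: (@le_trans _ _ (G w x)%:R%R); rewrite ?ler_nat // ler_peMl.
by rewrite !natrD; move: le1 le'; lra.
Qed.

End Segments.

Variables (E0 E : seq (edge n)) (B r M l : nat) (eta : R).
Hypotheses (M18 : 18 <= M) (Ml : 2 * l <= M) (eta0 : (0 <= eta)%R) (eta1 : (eta <=
  1)%R).
Hypothesis sE : sound d E.
Hypothesis accurate : forall u v, d u v <= 2 * r ->
  exists2 D, walk predT (augment G E0) B D u v &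
    (D%:R <= (1 + eta) * (d u v)%:R :> R)%R.

Local Notation seg := (seg r M l).
Local Notation rad := (rad r M l).
Local Notation reachd := (reachd r M l).
Local Notation hops := (hops M).
Local Notation err := (err r M l).
Local Notation X := (augment G E).

Variables (Ps : nat -> {set 'I_n}) (s : nat -> nat).
Hypothesis Ps0 : Ps 0 = [set: 'I_n].
Hypothesis PsS : forall i, i <= l ->
  phase_ok G E0 B (2 * reachd i, s i) (Ps i) (Ps i.+1) E.
Hypothesis Psl : #|Ps l| < s l.

(* The supercluster of v stops growing at level i: its center was unpopular. *)
Definition stops (i : nat) (v : 'I_n) : Prop :=
  exists x D, [/\ x \in Ps i, walk predT X i D v x, D <= rad i &
    forall y, y \in Ps i -> d x y <= reachd i ->
      exists2 D', walk predT X 1 D' x y & (D'%:R <= (1 + eta) * (d x y)%:R :> R)%R].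

Lemma stops_or_center i v : i <= l.+1 -> (exists2 j, j < i & stops j v) \/
  exists x D, [/\ x \in Ps i, walk predT X i D v x & D <= rad i].
Proof.
elim: i => [_|i IH il].
  by right; exists v, 0; rewrite Ps0 inE; split=> //; exact: walk_nil.
case: (IH (ltnW il)) => [[j ji st]|[x [D [xP wk Dr]]]]; first by left;
  exists j => //; lia.
have [_ /(_ x xP)[[q [w [qQ wt xqE]]]|un]] := PsS il.
  have [D' wk' D'w] := augment_edge dG sE xqE; right; exists q, (D + D'); split=> //.
    by rewrite -addn1; apply: walk_cat wk wk'.
  by move: wt D'w Dr; rewrite /= /reachd; lia.
left; exists i => //; exists x, D; split=> // y yP xy.
have [|D' wk' D'le] := @accurate x y; first by apply: leq_trans xy _; exact: reachd_le.
(* The threshold is [2 * reachd i] because the available walk may be [1 + eta <= 2] times longer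
   than the distance. *)
have D't : D' <= 2 * reachd i.
  rewrite -(ler_nat R) natrM; apply: le_trans D'le _; move: xy; rewrite -(ler_nat R).
  have := ler0n R (d x y); move: ((d x y)%:R)%R ((reachd i)%:R)%R => p q p0 pq.
  have : (0 <= (1 - eta) * p)%R by rewrite mulr_ge0 // subr_ge0.
  by lra.
have [e xyE eD'] := un y D' yP wk' D't; have [D'' wk'' le] := augment_edge dG sE xyE.
by exists D'' => //; apply: le_trans D'le; rewrite ler_nat; lia.
Qed.

Lemma all_stop v : exists2 j, j <= l & stops j v.
Proof.
have [[j jl st]|[x [D [+ _ _]]]] := stops_or_center v (leqnn l.+1); first by exists j.
(* The last phase leaves no center, since [#|Ps l.+1| * s l <= #|Ps l| < s l]. *)
suff -> : Ps l.+1 = finset.set0 by rewrite inE.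
apply/eqP; rewrite -cards_eq0; have [/= le _] := PsS (leqnn l).
by move: le Psl; move: #|_| => m; nia.
Qed.

(** Go from [x] to its center, along the edge to the center of [y], and on to [y]. The centers are
    at most [2 * rad i] farther apart than [x] and [y], so the excess is at most
    [(1 + eta) * 2 * rad i + 2 * rad i], that is, at most six radii. *)
Lemma stops_bridge i x y : stops i x -> stops i y -> d x y <= seg i ->
  exists2 D, walk predT X (2 * i + 1) D x y &
    (D%:R <= (1 + eta) * (d x y)%:R + 6 * (rad i)%:R :> R)%R.
Proof.
move=> [cx [D1 [xP w1 D1r near]]] [cy [D2 [yP w2 D2r _]]] xy.
have d1 := augment_walk_ge dG sE w1; have d2 := augment_walk_ge dG sE w2.
have dc : d cx cy <= D1 + d x y + D2.
  apply: leq_trans (gmetric_triangle dG y cx cy) (leq_add _ d2).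
  apply: leq_trans (gmetric_triangle dG x cx y) (leq_add _ (leqnn _)).
  by rewrite (gmetric_sym dG).
have [|D w Dle] := near cy yP; first by rewrite /reachd; lia.
exists (D1 + D + D2).
  have -> : 2 * i + 1 = i + 1 + i by lia.
  by apply: walk_cat (walk_sym w2); apply: walk_cat w1 w.
move: dc D1r D2r Dle; rewrite -!(ler_nat R) !natrD.
have := ler0n R (d cx cy); have := ler0n R (rad i).
move: (d cx cy)%:R%R (d x y)%:R%R D1%:R%R D2%:R%R (rad i)%:R%R => p q p1 p2 t.
move=> t0 p0 pq p1t p2t p3p; have e1 : (0 <= 1 + eta)%R by rewrite addr_ge0.
have : (0 <= (1 + eta) * (p1 + q + p2 - p))%R by rewrite mulr_ge0 ?subr_ge0.
have : (0 <= (1 + eta) * (2 * t - p1 - p2))%R by rewrite mulr_ge0 //; lra.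
have : (0 <= (1 - eta) * t)%R by rewrite mulr_ge0 ?subr_ge0.
by lra.
Qed.

Definition stops_by (i : nat) : pred 'I_n := fun v => `[< exists2 j, j <= i &
  stops j v >].

Lemma walk_of_level i h D u v : i <= l -> walk (stops_by i) G h D u v -> D <= seg i ->
  exists2 D', walk predT X (hops i) D' u v &
    (D'%:R <= (1 + eta) * D%:R + (err i)%:R :> R)%R.
Proof.
have k1 : (1 <= 1 + eta)%R by rewrite lerDl.
have k0 : (0 <= 1 + eta)%R by rewrite addr_ge0.
elim: i h D u v => [|i IH] h D u v il wk DL.
  have [/asboolP[[|//] _ su] /asboolP[[|//] _ sv]] := walk_ends wk.
  have duv := gmetric_le dG wk.
  have [D' w' le] := stops_bridge su sv (leq_trans duv DL); exists D' => //=.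
  by apply: le_trans le _; rewrite mulr0 lerD2r ler_wpM2l ?ler_nat.
have short D1 u1 v1 := IH h D1 u1 v1 (ltnW il); have c0 := ler0n R (err i).
have segi := segS r M18 il.
case: (walk_split_first (stops_by i) wk) => [wk'|[x [D1 [D2 [pr1 nx wk2 DE]]]]].
  have [D' w' le] := walk_segments k1 c0 short wk' (ltn_ceil D (ltn0Sn _)).
  exists D'.
    apply: walk_weaken w' => //=.
    have : D %/ (seg i).+1 < M by rewrite ltn_divLR //; lia.
    by move: (D %/ _) (hops i) => q y; nia.
  apply: le_trans le _; rewrite lerD2l -natrM ler_nat /=.
  have : D %/ (seg i).+1 < M by rewrite ltn_divLR //; lia.
  by move: (D %/ _) (err i) => q y; nia.
(* Splitting the reversed remainder yields the last vertex [y] that stops at level [i + 1]. *)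
case: (walk_split_first (stops_by i) (walk_sym wk2)) => [/walk_ends[_ xs]|].
  by rewrite xs in nx.
move=> [y [D3 [D4 [pr3 ny wk4 D2E]]]].
have last_level z : stops_by i.+1 z -> ~~ stops_by i z -> stops i.+1 z.
  move=> /asboolP[j ji st] nz; have [<-//|nij] := eqVneq j i.+1.
  by case/asboolP: nz; exists j => //; lia.
have [sy sx] := walk_ends wk4.
have dyx := gmetric_le dG wk4.
have [|Dm wm lem] := stops_bridge (last_level _ sx nx) (last_level _ sy ny).
  by rewrite (gmetric_sym dG); apply: leq_trans dyx (leq_trans _ DL);
    rewrite DE D2E addnA leq_addl.
rewrite (gmetric_sym dG) in lem.
have [D1' w1 le1] := pre_segments k1 c0 short pr1 (ltn_ceil D1 (ltn0Sn _)).
have [D3' w3 le3] := pre_segments k1 c0 short pr3 (ltn_ceil D3 (ltn0Sn _)).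
(* The two outer parts together are shorter than [M * (seg i).+1], so rounding both counts up gives
   at most [M + 1] pieces. *)
have qM : D1 %/ (seg i).+1 + D3 %/ (seg i).+1 < M.
  rewrite -(ltn_pmul2r (ltn0Sn (seg i))) mulnDl.
  apply: leq_ltn_trans (leq_add (leq_divM _ _) (leq_divM _ _)) (leq_ltn_trans _ segi).
  by apply: leq_trans DL; rewrite DE D2E addnA leq_addr.
have qz z : (D1 %/ (seg i).+1).+1 * z + (D3 %/ (seg i).+1).+1 * z <= M.+1 * z.
  by rewrite -mulnDl leq_mul2r addSn addnS ltnS qM orbT.
exists (D1' + Dm + D3').
  apply: walk_weaken (walk_cat (walk_cat w1 wm) (walk_sym w3)) => //=.
  have -> : 2 * i.+1 + 1 = 2 * i + 3 by clear; lia.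
  by rewrite addnAC leq_add2r.
have : ((D1 %/ (seg i).+1).+1%:R * (err i)%:R + (D3 %/ (seg i).+1).+1%:R * (err i)%:R
    <= M.+1%:R * (err i)%:R :> R)%R by rewrite -!natrM -natrD ler_nat.
have : ((1 + eta) * (d y x)%:R <= (1 + eta) * D4%:R)%R.
  by rewrite ler_wpM2l ?ler_nat.
have -> : ((err i.+1)%:R = M.+1%:R * (err i)%:R + 6 * (rad i.+1)%:R :> R)%R.
  by rewrite -!natrM -natrD.
rewrite DE D2E (natrD _ (D1' + Dm)) (natrD _ D1') (natrD _ D1) (natrD _ D3).
by move: lem le1 le3; lra.
Qed.

Lemma walk_of_scale u v : d u v <= r ->
  exists2 D, walk predT X (hops l) D u v &
    (D%:R <= (1 + eta) * (d u v)%:R + (err l)%:R :> R)%R.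
Proof.
move=> duv; have [h wk] := dG.1 u v.
apply: (walk_of_level (h := h)) => //; last by rewrite seg_top.
by apply: walk_weaken wk => // w _; apply/asboolP; exact: all_stop.
Qed.

End Stretch.

(** * All scales *)

Lemma walk_length0 n a (X : wgraph n) h u v : walk a X h 0 u v -> u = v.
Proof.
case/walk_inv=> [[]//|[h' [w [D' [_ + _ eq]]]]].
by rewrite adjE; have -> : X u w = 0 by lia.
Qed.

Section Scales.
Variables (R : realType) (n W : nat).
Local Notation view := {ffun 'I_n -> nat}.
Local Notation program := (prog n (message n W 3) view).
Variables (M l tau beta : nat) (s : nat -> nat).

(* A path of length at most 2^(k+2) splits into 2^(tau+1) + 1 pieces, each of
   them served by beta hops of the earlier scales, joined by single edges. *)
Definition depth : nat := (2 ^ tau.+1).+1 * beta + 2 ^ tau.+1.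

Definition schedule (k : nat) : seq (nat * nat) :=
  [seq (2 * reachd (2 ^ k.+1) M l i, s i) | i <- iota 0 l.+1].

(** Scale [k] explores with the completed groups of [tau] scales only, so that the error accumulates
    once per group and not once per scale. *)
Definition next_scale (Es : seq (seq (edge n))) : program (seq (seq (edge n))) :=
  bind (phases W (flatten (take (size Es %/ tau * tau) Es)) depth
          (schedule (size Es)) [set: 'I_n])
    (fun E => Ret _ _ _ (rcons Es E)).

Definition all_scales (K : nat) : program (seq (seq (edge n))) :=
  repeat K next_scale [::].

Variables (G : wgraph n) (d : 'I_n -> 'I_n -> nat).
Hypothesis dG : is_metric_of G d.
Variables (e S : R) (K smax : nat).
Hypotheses (M18 : 18 <= M) (Ml : 2 * l <= M) (tau0 : 0 < tau).
Hypotheses (e0 : (0 <= e)%R) (eM : (192 * l%:R <= M%:R * e)%R).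
Hypothesis eK : forall k, k < K -> ((k %/ tau).+1%:R * e <= 1)%R.
Hypothesis betaE : hops M l <= beta.
Hypothesis s_ok : forall i, i <= l -> 0 < s i <= smax.
Hypothesis K_ok : 4 * 2 ^ K < n * W.+1.
Hypothesis sizes : forall m : nat -> nat, m 0 = n ->
  (forall i, i <= l -> m i.+1 * s i <= m i) ->
  ((\sum_(i < l.+1) m i * s i)%:R <= S)%R /\ m l < s l.

Definition good_scale (j : nat) (E : seq (edge n)) : Prop :=
  [/\ sound d E, ((size E)%:R <= S)%R &
    forall u v, 2 ^ j < d u v <= 2 ^ j.+1 ->
      exists2 D, walk predT (augment G E) beta D u v &
        (D%:R <= (1 + (j %/ tau).+1%:R * e) * (d u v)%:R :> R)%R].

Definition good_scales (k : nat) (Es : seq (seq (edge n))) : Prop :=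
  size Es = k /\ forall j, j < k -> good_scale j (nth [::] Es j).

Lemma sound_flatten k Es N : good_scales k Es -> sound d (flatten (take N Es)).
Proof.
case=> sz good u v w /flattenP[E /mem_take/(nthP [::])[j jk <-]].
by case: (good j); rewrite -?sz // => sE _ _; apply: sE.
Qed.

(** Distances of at least 2 belong to a scale [j < N]. No scale covers distance 1, which is realized
    by an edge of [G]. *)
Lemma good_scales_walk k Es N f u v : good_scales k Es -> N <= k ->
  (forall j, j < N -> j %/ tau < f) -> d u v <= 2 ^ N ->
  exists2 D, walk predT (augment G (flatten (take N Es))) beta D u v &
    (D%:R <= (1 + f%:R * e) * (d u v)%:R :> R)%R.
Proof.
move=> gs Nk fN dN; have [sz good] := gs; have snd : sound d (flatten (take N Es)) :=
  sound_flatten gs.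
have f1 : (1 <= 1 + f%:R * e)%R by rewrite lerDl mulr_ge0.
have [<-|uv] := eqVneq u v.
  by exists 0; [exact: walk_nil|rewrite mulr_ge0 //; exact: le_trans f1].
have d0 := gmetric_gt0 dG uv.
case: (ltnP 1 (d u v)) => [d1|d1].
  have /andP[dlo dhi] := up_log_bounds (isT : 1 < 2) d1.
  have up0 : 0 < up_log 2 (d u v) by rewrite up_log_gt0.
  set j := (up_log 2 (d u v)).-1 in dlo.
  have jE : up_log 2 (d u v) = j.+1 by rewrite /j prednK.
  rewrite jE in dhi; have jN : j < N.
    by rewrite -(ltn_exp2l _ _ (isT : 1 < 2)); exact: leq_trans dN.
  have [|_ _ /(_ u v)] := good j; first by lia.
  rewrite dlo dhi => /(_ isT)[D wk Dle].
  have sub : {subset nth [::] Es j <= flatten (take N Es)}.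
    move=> x xE; apply/flattenP; exists (nth [::] Es j) => //.
    by rewrite -(nth_take _ jN) mem_nth // size_takel ?sz.
  have [D' wk' le] := augment_sub dG snd sub wk; exists D' => //.
  apply: le_trans (_ : (D%:R <= _)%R); first by rewrite ler_nat.
  apply: le_trans Dle _; rewrite ler_wpM2r // lerD2l ler_wpM2r // ler_nat.
  exact: fN.
have de : d u v = 1 by lia.
have [h /walk_inv[[/eqP]|[h' [w [D' [_ uw wk DE]]]]]] := dG.1 u v.
  by rewrite (negbTE uv).
have D'0 : D' = 0 by move: uw; rewrite adjE; lia.
rewrite D'0 in wk; have wv := walk_length0 wk; rewrite wv in uw DE.
have [av le] := augment_base_edge (flatten (take N Es)) uw.
exists (augment G (flatten (take N Es)) u v).
  have b0 : 0 < beta by apply: leq_trans betaE; exact: leq_ltn_trans (hops_gt M l).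
  by apply: (walk_weaken _ b0 (walk_edge (a := predT) _ _ av)).
rewrite de mulr1; apply: le_trans f1; rewrite -[1%R]/(1%:R)%R ler_nat.
by apply: leq_trans le _; lia.
Qed.

Lemma yields_next_scale k Es : k < K -> good_scales k Es ->
  yields (local_view G) (next_scale Es) (l.+1 * (depth * smax)) (good_scales k.+1).
Proof.
move=> kK gs; have [sz good] := gs.
set g := k %/ tau; set E0 := flatten (take (g * tau) Es).
have sE0 : sound d E0 by exact: sound_flatten gs.
have gk : g * tau <= k by exact: leq_divM.
have kg : k < g * tau + tau by rewrite addnC -mulSn; exact: ltn_ceil.
pose eta : R := (g%:R * e)%R.
have eta0 : (0 <= eta)%R by rewrite mulr_ge0.
have eta_e : (eta + e <= 1)%R by have := eK kK; rewrite -natr1 mulrDl mul1r.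
have eta1 : (eta <= 1)%R by apply: le_trans eta_e; rewrite lerDl.
have k1 : (1 <= 1 + eta)%R by rewrite lerDl.
have accurate u v : d u v <= 2 * 2 ^ k.+1 ->
    exists2 D, walk predT (augment G E0) depth D u v &
      (D%:R <= (1 + eta) * (d u v)%:R :> R)%R.
  move=> duv; have [h wk] := dG.1 u v.
  have short D x y : walk predT G h D x y -> D <= 2 ^ (g * tau) ->
      exists2 D', walk predT (augment G E0) beta D' x y &
        (D'%:R <= (1 + eta) * D%:R + 0 :> R)%R.
    move=> wxy DL; have dxy := gmetric_le dG wxy.
    have [|D' w' le] := good_scales_walk gs gk _ (leq_trans dxy DL) (f := g).
      by move=> j jg; rewrite ltn_divLR.
    exists D' => //; rewrite addr0; apply: le_trans le _.
    by rewrite ler_wpM2l ?ler_nat //; apply: le_trans k1.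
  (* As [k < g * tau + tau], the length [2 ^ (k + 2)] is at most [2 ^ tau.+1] times the length
     [2 ^ (g * tau)] covered by the completed groups. *)
  have [|D w' le] := walk_segments k1 (lexx 0%R) short (q := 2 ^ tau.+1) wk.
    apply: leq_ltn_trans duv _; rewrite -expnS.
    apply: (@leq_ltn_trans (2 ^ tau.+1 * 2 ^ (g * tau))); last by apply: ltn_mul.
    by rewrite -expnD leq_exp2l //; lia.
  by exists D => //; rewrite mulr0 addr0 in le.
have sched_nth i : i <= l -> nth (0, 0) (schedule k) i = (2 * reachd (2 ^ k.+1) M l
  i, s i).
  by move=> il; rewrite (nth_map 0) ?size_iota // nth_iota.
have size_sched : size (schedule k) = l.+1 by rewrite size_map size_iota.
have sched_ok : all (fun t => [&& 0 < t.2, t.2 <= smax & t.1 < n * W.+1]) (schedule k).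
  apply/(all_nthP (0, 0)) => i; rewrite size_sched ltnS => il.
  rewrite sched_nth //=; have /andP[-> ->] := s_ok il => /=.
  apply: leq_ltn_trans K_ok; have := reachd_le (2 ^ k.+1) M18 il.
  have : 2 ^ k.+1 <= 2 ^ K by rewrite leq_exp2l.
  by move: (2 ^ K) (2 ^ k.+1) (reachd _ _ _ _); lia.
have := yields_phases depth dG sE0 [set: 'I_n] sched_ok.
rewrite size_sched => -[le [sE [Ps [Ps0 szE okE]]]].
rewrite /next_scale sz /yields rounds_bind result_bind /= addn0; split=> //.
set E := result _ _ in sE szE okE *.
have PsS i : i <= l -> phase_ok G E0 depth (2 * reachd (2 ^ k.+1) M l i,
  s i) (Ps i) (Ps i.+1) E.
  by move=> il; rewrite -sched_nth //; apply: okE; rewrite size_sched.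
have [||szS Psl] := sizes (m := fun i => #|Ps i|).
- by rewrite Ps0 cardsT card_ord.
- by move=> i /PsS[].
split=> [|j]; first by rewrite size_rcons sz.
rewrite nth_rcons sz ltnS leq_eqVlt => /orP[/eqP ->|jk]; last first.
  by rewrite jk; exact: good.
rewrite ltnn eqxx; split=> //.
  apply: le_trans szS; rewrite ler_nat; apply: leq_trans szE _; rewrite size_sched.
  by apply: eq_leq; apply: eq_bigr => i _; rewrite sched_nth // -ltnS.
move=> u v /andP[dlo dhi].
have [D wk Dle] := walk_of_scale dG M18 Ml eta0 eta1 sE accurate Ps0 PsS Psl dhi.
exists D; first exact: walk_weaken wk.
apply: le_trans Dle _; have -> : ((1 + (k %/ tau).+1%:R * e) * (d u v)%:R =
    (1 + eta) * (d u v)%:R + e * (d u v)%:R :> R)%R by rewrite -natr1 /eta -/g; ring.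
rewrite lerD2l.
(* Here [r] is [2 ^ k.+1], so the 96 of [err_le] becomes the 192 of [eM]; distances of this scale
   exceed [2 ^ k], so the additive error is relative to them. *)
have errle : ((err (2 ^ k.+1) M l l)%:R <= e * (2 ^ k)%:R :> R)%R.
  have M0 : (0 < M%:R :> R)%R by rewrite ltr0n (leq_trans _ M18).
  rewrite -(ler_pM2l M0) mulrA.
  have := err_le (2 ^ k.+1) M18 Ml (leqnn l); rewrite subnn expn0 mul1n.
  rewrite -(ler_nat R) natrM mulrC => /le_trans; apply.
  rewrite expnS mulnA natrM ler_wpM2r //.
  by apply: le_trans eM; rewrite -natrM ler_nat mulnAC.
by apply: le_trans errle _; rewrite ler_wpM2l // ler_nat ltnW.
Qed.

Lemma yields_all_scales : yields (local_view G) (all_scales K)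
  (K * (l.+1 * (depth * smax))) (good_scales K).
Proof.
by apply: yields_repeat => // j Es; exact: yields_next_scale.
Qed.

End Scales.

(** * Degree sequence *)

Local Open Scope ring_scope.

Section Degrees.
Variables (R : realType) (N Q : R).
Hypotheses (N1 : 1 <= N) (Q1 : 1 <= Q).

(* Here N = n^(1/kappa) and Q = n^rho.  With N ^ 2 ^ i alone, every phase could
   contribute n N edges; the factors 2 make the contributions decrease as
   4 n N / 2^i (see [degree_ratio]) while the exponents still double. *)
Definition growth (i : nat) : R := 2 * (2 * N) ^+ (2 ^ i).

Definition degree (i : nat) : R := Num.min (2 * Q) (growth i).

Definition degree_prod (i : nat) : R := \prod_(j < i) degree j.

(** Rounding strictly upwards yields the strict inequality [m l < s l] at the end, and costs a
    factor of at most 2. *)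
Definition degree_up (i : nat) : nat := (Num.truncn (degree i)).+1.

Lemma twoN_ge2 : 2 <= 2 * N. Proof. by rewrite ler_peMr. Qed.

Lemma twoN_ge1 : 1 <= 2 * N. Proof. by apply: le_trans twoN_ge2; rewrite ler1n. Qed.

Lemma growth_mono i j : (i <= j)%N -> growth i <= growth j.
Proof.
by move=> ij; rewrite ler_pM2l ?ltr0n // ler_weXn2l ?twoN_ge1 // leq_exp2l.
Qed.

Lemma growth_ge2 i : 2 <= growth i.
Proof. by rewrite ler_peMr // exprn_ege1 // twoN_ge1. Qed.

Lemma degree_ge2 i : 2 <= degree i.
Proof. by rewrite le_min growth_ge2 ler_peMr. Qed.

Lemma degree_le i : degree i <= 2 * Q.
Proof. by rewrite ge_min lexx. Qed.

Lemma degree_prod_gt0 i : 0 < degree_prod i.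
Proof. by apply: prodr_gt0 => j _; apply: lt_le_trans (degree_ge2 j). Qed.

Lemma degree_prodS i : degree_prod i.+1 = degree_prod i * degree i.
Proof. by rewrite /degree_prod big_ord_recr. Qed.

(** The exponents [2 ^ j] sum to [2 ^ i - 1]; the factor [2 * N] avoids the subtraction. *)
Lemma degree_prod_small i : (forall j, (j < i)%N -> growth j <= 2 * Q) ->
  degree_prod i * (2 * N) = 2 ^+ i * (2 * N) ^+ (2 ^ i).
Proof.
elim: i => [|i IH] small; first by rewrite /degree_prod big_ord0 mul1r.
rewrite degree_prodS mulrAC IH => [|j ji]; last by apply: small; lia.
rewrite /degree min_r ?small // /growth.
rewrite expnS mul2n -addnn exprD (exprS _ i); ring.
Qed.

Lemma degree_prod_large i j : (forall k, (i <= k)%N -> 2 * Q < growth k) ->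
  degree_prod (i + j) = degree_prod i * (2 * Q) ^+ j.
Proof.
move=> large; elim: j => [|j IH]; first by rewrite addn0 mulr1.
have dE : degree (i + j) = 2 * Q by rewrite /degree min_l // ltW // large // leq_addr.
by rewrite addnS degree_prodS IH dE -mulrA -exprSr.
Qed.

(** While the growth is uncapped, [degree_prod_small] gives the bound. Afterwards the degree no
    longer grows, and the product gains a factor of at least 2 per step, matching [2 ^+ i]. *)
Lemma degree_ratio i : degree i * 2 ^+ i <= 4 * N * degree_prod i.
Proof.
elim: i => [|i IH].
  rewrite /degree_prod big_ord0 expr0 !mulr1.
  by apply: (@le_trans _ _ (growth 0)); rewrite ?ge_min ?lexx ?orbT // /growth expn0
    expr1; lra.
have [small|large] := lerP (growth i) (2 * Q).
  have -> : 4 * N * degree_prod i.+1 = growth i.+1 * 2 ^+ i.+1.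
    transitivity (2 * (degree_prod i.+1 * (2 * N))); first by ring.
    rewrite degree_prod_small; first by rewrite /growth; ring.
    by move=> j ji; apply: le_trans small; apply: growth_mono.
  by rewrite ler_wpM2r ?exprn_ge0 // ge_min lexx orbT.
rewrite degree_prodS exprS.
have dE : degree i = 2 * Q by rewrite /degree min_l // ltW.
have dp : 0 <= N * degree_prod i.
  by rewrite mulr_ge0 ?(ltW (degree_prod_gt0 _)) // (le_trans _ N1).
apply: (@le_trans _ _ (2 * (degree i * 2 ^+ i))).
  by rewrite mulrCA ler_pM2l // dE ler_wpM2r ?exprn_ge0 ?degree_le.
apply: (@le_trans _ _ (2 * (4 * N * degree_prod i))); first by rewrite ler_pM2l.
by have := degree_ge2 i; move: dp; nra.
Qed.

Lemma degree_up_gt i : degree i < (degree_up i)%:R.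
Proof. exact: truncnS_gt. Qed.

Lemma degree_up_le i : (degree_up i)%:R <= 2 * degree i.
Proof.
have d2 := degree_ge2 i.
have : (Num.truncn (degree i))%:R <= degree i by rewrite truncn_le (le_trans _ d2).
by rewrite /degree_up -natr1; lra.
Qed.

Section Sizes.
Variables (n : nat) (m : nat -> nat).
Hypotheses (m0 : m 0%N = n).

Lemma centers_le l i : (i <= l.+1)%N ->
  (forall j, (j <= l)%N -> (m j.+1 * degree_up j <= m j)%N) ->
  (m i)%:R * degree_prod i <= n%:R.
Proof.
move=> + mS; elim: i => [|i IH] il; first by rewrite m0 /degree_prod big_ord0 mulr1.
apply: le_trans (IH (ltnW il)); rewrite degree_prodS mulrCA mulrC.
rewrite ler_pM2r ?degree_prod_gt0 //.
apply: (@le_trans _ _ ((m i.+1)%:R * (degree_up i)%:R));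
  last by rewrite -natrM ler_nat mS.
by rewrite ler_wpM2l // ltW ?degree_up_gt.
Qed.

Lemma edges_le l : (forall j, (j <= l)%N -> (m j.+1 * degree_up j <= m j)%N) ->
  (\sum_(i < l.+1) m i * degree_up i)%N%:R <= 16 * (n%:R * N).
Proof.
move=> mS; have nN : 0 <= n%:R * N by rewrite mulr_ge0 // (le_trans _ N1).
(* Partial sums of a geometric series: phase [i] contributes at most [8 * n * N / 2 ^ i], with 4
   from [degree_ratio] and 2 from rounding. *)
suff term i : (i <= l.+1)%N ->
    (\sum_(j < i) m j * degree_up j)%N%:R <= 16 * (n%:R * N) * (1 - 2^-1 ^+ i).
  have e0 : 0 <= 2^-1 ^+ l.+1 :> R by rewrite exprn_ge0 // invr_ge0.
  by apply: le_trans (term _ (leqnn _)) _; apply: ler_piMr;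
    [exact: mulr_ge0|rewrite gerBl].
elim: i => [|i IH] il; first by rewrite big_ord0 subrr mulr0.
rewrite big_ord_recr /= natrD; have := IH (ltnW il); rewrite exprS.
suff : (m i * degree_up i)%N%:R <= 8 * (n%:R * N) * 2^-1 ^+ i by lra.
have e0 : 0 < 2^-1 ^+ i :> R by rewrite exprn_gt0 // invr_gt0.
have ce := centers_le (ltnW il) mS.
have p0 := degree_prod_gt0 i.
have h1 : degree i <= 4 * N * degree_prod i * 2^-1 ^+ i.
  by rewrite exprVn ler_pdivlMr ?exprn_gt0 //; exact: degree_ratio.
rewrite natrM; apply: (@le_trans _ _ ((m i)%:R * (2 * (4 * N * degree_prod i * 2^-1
  ^+ i)))).
  rewrite ler_wpM2l //; apply: le_trans (degree_up_le i) _.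
  by rewrite ler_pM2l.
have -> : (m i)%:R * (2 * (4 * N * degree_prod i * 2^-1 ^+ i)) =
  (8 * N * 2^-1 ^+ i) * ((m i)%:R * degree_prod i) by ring.
have -> : 8 * (n%:R * N) * 2^-1 ^+ i = (8 * N * 2^-1 ^+ i) * n%:R by ring.
by rewrite ler_wpM2l // mulr_ge0 ?ltW // mulr_gt0 // (lt_le_trans _ N1).
Qed.

End Sizes.

Lemma exists_large_growth : exists i, Q < (2 * N) ^+ (2 ^ i).
Proof.
exists (Num.truncn Q); apply: lt_le_trans (truncnS_gt Q) _.
apply: (@le_trans _ _ (2 ^+ (2 ^ Num.truncn Q))); last first.
  by rewrite lerXn2r // ?nnegrE ?twoN_ge2 // (le_trans _ twoN_ge2).
rewrite -natrX ler_nat.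
exact: leq_trans (ltn_expl _ (isT : (1 < 2)%N)) (ltnW (ltn_expl _ (isT : (1 < 2)%N))).
Qed.


End Degrees.

(** * Logarithms and the number of phases *)

Lemma log2_pow (R : realType) (m : nat) : log2 (2 ^+ m : R) = m%:R.
Proof.
rewrite /log2 lnXn // -[ln _ *+ m]mulr_natl mulfK // gt_eqF //.
by apply: ln_gt0; rewrite ltr1n.
Qed.

Lemma ln2_gt0 (R : realType) : 0 < ln (2 : R).
Proof. by apply: ln_gt0; rewrite ltr1n. Qed.

Lemma ler_log2 (R : realType) (x y : R) : 0 < x -> x <= y -> log2 x <= log2 y.
Proof.
move=> x0 xy; rewrite /log2 ler_pM2r ?invr_gt0 ?ln2_gt0 //.
by rewrite ler_ln // posrE (lt_le_trans x0).
Qed.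

Lemma le_log2 (R : realType) (x : R) (m : nat) : (0 < m)%N -> m%:R <= log2 x ->
  2 ^+ m <= x.
Proof.
move=> m0 mx; have x0 : 0 < x.
  rewrite ltNge; apply/negP => x0; have : log2 x <= 0.
    by rewrite /log2 pmulr_lle0 ?invr_gt0 ?ln2_gt0 // ln_le0 // (le_trans x0).
  by apply/negP; rewrite -ltNge (lt_le_trans _ mx) // ltr0n.
move: mx; rewrite -log2_pow /log2 ler_pM2r ?invr_gt0 ?ln2_gt0 //.
by rewrite ler_ln // posrE exprn_gt0.
Qed.

(** The degrees grow until the first [i1] at which [2 * N] to the power [2 ^ i1] exceeds [Q], then
    [j] phases of degree [2 * Q] follow, after which too few centers remain to fill a list. *)
Lemma degrees_exist (R : realType) (n : nat) (kappa rho : R) :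
  (1 < n)%N -> 2 <= kappa -> rho < 2^-1 -> kappa^-1 <= rho ->
  exists (l : nat) (s : nat -> nat),
    [/\ l%:R <= log2 kappa + rho^-1,
      forall i, (0 < s i)%N /\ (s i)%:R <= 4 * n%:R `^ rho &
      forall m : nat -> nat, m 0%N = n ->
        (forall i, (i <= l)%N -> (m i.+1 * s i <= m i)%N) ->
        (\sum_(i < l.+1) m i * s i)%N%:R <= 16 * n%:R `^ (1 + kappa^-1) /\
        (m l < s l)%N].
Proof.
move=> n2 k2 r2 kr.
have k0 : 0 < kappa by lra.
have ki0 : 0 < kappa^-1 by rewrite invr_gt0.
have r0 : 0 < rho by lra.
have n1 : 1 <= n%:R :> R by rewrite ler1n ltnW.
have nn0 : n%:R != 0 :> R by rewrite pnatr_eq0 -lt0n ltnW.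
pose N : R := n%:R `^ kappa^-1; pose Q : R := n%:R `^ rho.
have pow1 (x : R) : 0 <= x -> 1 <= n%:R `^ x.
  by move=> x0; rewrite -[leLHS](powRr0 n%:R) ler_powR.
have N1 : 1 <= N by apply: pow1; lra.
have Q1 : 1 <= Q by apply: pow1; lra.
have nNE : n%:R `^ (1 + kappa^-1) = n%:R * N.
  by rewrite powRD ?nn0 ?implybT // powRr1.
have [i1 i1P i1min] := ex_minnP (exists_large_growth Q N1).
have i1le : i1%:R <= log2 kappa.
  case: i1 i1P i1min => [|i] _ i1min.
    have : log2 (2 ^+ 1 : R) <= log2 kappa by apply: ler_log2.
    by rewrite log2_pow; lra.
  (* By minimality the previous power is at most [Q], so [2 ^ i / kappa <= rho < 1 / 2], whence
     [2 ^ i.+1 <= kappa]. *)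
  have lt : (2 * N) ^+ (2 ^ i) <= Q.
    by rewrite leNgt; apply/negP => /i1min; rewrite ltnn.
  have : N ^+ (2 ^ i) <= Q.
    by apply: le_trans lt; rewrite lerXn2r ?nnegrE; lra.
  rewrite /N -powR_mulrn ?powR_ge0 // -powRrM => le.
  have e_le : kappa^-1 * (2 ^ i)%N%:R <= rho.
    have lnn : 0 < ln (n%:R : R) by rewrite ln_gt0 // ltr1n.
    rewrite -(ler_pM2r lnn) -!ln_powR ler_ln ?posrE ?powR_gt0 ?ltr0n ?(ltnW n2) //.
  rewrite -log2_pow; apply: ler_log2; first by rewrite exprn_gt0.
  rewrite exprS; move: e_le; rewrite natrX mulrC ler_pdivrMr // => le2.
  have : rho * kappa <= 2^-1 * kappa by rewrite ler_pM2r // ltW.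
  by lra.
have kr1 : (kappa * rho)^-1 <= 1.
  by rewrite invf_le1 ?mulr_gt0 // -(mulfV (lt0r_neq0 k0)) ler_pM2l.
have rho2 : 2 < rho^-1 by rewrite -[2]invrK ltf_pV2 ?posrE.
(* Since [rho * x = 1 + 1 / kappa], the power [Q ^+ j.+2] reaches [n * N] as soon as [x < j + 2].
   The last summand is at most 1, so [j + 1 <= x] gives [j <= 1 / rho]. *)
pose x : R := rho^-1 + (kappa * rho)^-1.
have kr0 : 0 < (kappa * rho)^-1 by rewrite invr_gt0 mulr_gt0.
have x0 : 0 <= x by rewrite /x; lra.
have /andP[cx xc] := truncn_itv x0.
case: (Num.truncn x) cx xc => [_|j cx xc]; first by rewrite /x; lra.
exists (i1 + j)%N, (degree_up N Q); split.
- by rewrite natrD; move: cx; rewrite -natr1 /x; lra.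
- move=> i; split=> //; apply: le_trans (degree_up_le N1 Q1 i) _.
  by have := degree_le N Q i; rewrite -/Q; lra.
move=> m m0 mS; rewrite nNE; split; first exact: edges_le.
rewrite -(ltr_nat R); apply: le_lt_trans (degree_up_gt N Q (i1 + j)).
have large k : (i1 <= k)%N -> 2 * Q < growth N k.
  by move=> /(growth_mono N1); apply: lt_le_trans; rewrite ltr_pM2l.
have -> : degree N Q (i1 + j) = 2 * Q by rewrite /degree min_l // ltW // large //
  leq_addr.
have p0 := degree_prod_gt0 N1 Q1 (i1 + j).
rewrite -(ler_pM2r p0); apply: le_trans (centers_le N1 Q1 m0 _ mS) _;
  first exact: leqnSn.
have N20 : 0 < 2 * N by lra.
rewrite degree_prod_large // -(ler_pM2r N20).
have small k : (k < i1)%N -> growth N k <= 2 * Q.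
  by move=> ki; rewrite ler_pM2l // leNgt; apply/negP => /i1min; rewrite leqNgt ki.
have -> : 2 * Q * (degree_prod N Q i1 * (2 * Q) ^+ j) * (2 * N) =
    (degree_prod N Q i1 * (2 * N)) * (2 * Q) ^+ j.+1 by rewrite exprS; ring.
rewrite degree_prod_small // (exprMn j.+1 2 Q).
(* The growth phases supply one factor [Q] beyond [(2 * Q) ^+ j.+1]. *)
have pQ : Q <= 2 ^+ i1 * (2 * N) ^+ (2 ^ i1).
  by apply: le_trans (ltW i1P) _; rewrite ler_peMl ?exprn_ege1 ?exprn_ge0 ?ler1n //;
    lra.
have Q0 : 0 <= Q by lra.
apply: (@le_trans _ _ (Q * (2 * Q ^+ j.+1))); last first.
  by apply: ler_pM => //; [rewrite mulr_ge0 ?exprn_ge0|rewrite ler_wpM2r ?exprn_ge0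
    // exprS ler_peMr ?exprn_ege1 ?ler1n].
have -> : n%:R * (2 * N) = 2 * n%:R `^ (1 + kappa^-1) by rewrite nNE; ring.
have -> : Q * (2 * Q ^+ j.+1) = 2 * Q ^+ j.+2 by rewrite (exprS Q j.+1); ring.
rewrite ler_pM2l // /Q -powR_mulrn ?powR_ge0 // -powRrM ler_powR //.
have -> : 1 + kappa^-1 = rho * x.
  by rewrite /x invfM mulrDr mulfV ?lt0r_neq0 // mulrCA mulfV ?lt0r_neq0 // mulr1.
by rewrite ler_pM2l // ltW.
Qed.

(** * Distances, rounds and hop bounds *)

Lemma hop_dist_le_walk (R : realType) n (X : wgraph n) h D u v :
  walk predT X h D u v -> (hop_dist R h X u v <= (D%:R : R)%:E)%E.
Proof.
case/walk_pathP => p [pb ps pl]; apply: ereal_inf_lbound.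
by exists p => //=; rewrite pl.
Qed.

Lemma hop_dist_ge_walk (R : realType) n (X : wgraph n) h m u v :
  (forall D, walk predT X h D u v -> (m <= D)%N) ->
  ((m%:R : R)%:E <= hop_dist R h X u v)%E.
Proof.
move=> le; apply: le_ereal_inf_tmp => _ [p [pb ps] <-].
by rewrite lee_fin ler_nat; apply: le; apply/walk_pathP; exists p.
Qed.

(** A finite diameter makes every distance finite; path lengths being natural numbers, the infimum
    is attained. *)
Lemma dist_metric (R : realType) n (G : wgraph n) (L : nat) :
  diameter R G = L%:R%:E -> exists d : 'I_n -> 'I_n -> nat,
    [/\ is_metric_of G d, forall u v, dist R G u v = (d u v)%:R%:E &
      forall u v, (d u v <= L)%N].
Proof.
move=> diamG.
have dist_le u v : (dist R G u v <= L%:R%:E)%E.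
  by rewrite -diamG; apply: ereal_sup_ubound; exists (u, v).
have ex u v : exists m : nat, (exists h, walk predT G h m u v) /\
    forall h D, walk predT G h D u v -> (m <= D)%N.
  have : (dist R G u v < +oo)%E by apply: le_lt_trans (dist_le u v) _; exact: ltry.
  case/ereal_inf_lt => _ [p pb _] _.
  have exm : exists m, `[< exists h, walk predT G h m u v >].
    exists (path_length G u p); apply/asboolP; exists (size p).
    by apply/walk_pathP; exists p.
  case: (ex_minnP exm) => m /asboolP mw mmin; exists m; split=> // h D wk.
  by apply: mmin; apply/asboolP; exists h.
have [d dP] := choice (fun uv => ex uv.1 uv.2).
have distE u v : dist R G u v = (d (u, v))%:R%:E.
  have [[h wk] dmin] := dP (u, v); apply/eqP; rewrite eq_le; apply/andP; split.
    have [p [pb ps pl]] := (walk_pathP _ _ _ _ _).1 wk.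
    by apply: ereal_inf_lbound; exists p; rewrite //= pl.
  apply: le_ereal_inf_tmp => _ [p pb <-]; rewrite lee_fin ler_nat.
  by apply: (dmin (size p)); apply/walk_pathP; exists p.
exists (fun u v => d (u, v)); split=> // [|u v].
  by split=> [u v|h D u v]; have [wk dmin] := dP (u, v) => //; apply: dmin.
by rewrite -(ler_nat R) -lee_fin -distE.
Qed.

(** With zero random bits there is a single outcome: the expectation is the value itself and the
    probability is 1. *)
Lemma solves_deterministic (R : realType) n W (Y : Type)
    (p : prog n (message n W 3) {ffun 'I_n -> nat} Y) out (G H : wgraph n)
    (spec : wgraph n -> Prop) (size_bound round_bound c : R) :
  (forall v, local_view H v = out (result (local_view G) p) v (local_view G v)) ->
  spec H -> (num_edges H)%:R <= size_bound ->
  (rounds (local_view G) p)%:R <= round_bound ->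
  solves (alg_of p out) G spec size_bound round_bound c.
Proof.
move=> HE specH sizeH roundsH.
have coins0 : #|coins (alg_of p out)|%:R != 0 :> R.
  by rewrite card_ffun card_tuple expn0 exp1n oner_eq0.
exists (fun=> H), (fun=> rounds (local_view G) p); split=> //.
- by move=> w; apply: computes_alg_of.
- by rewrite /expectation sumr_const cardT -cardE -[_ *+ _]mulr_natr mulfK.
- rewrite /prob roundsH (eq_card (B := coins (alg_of p out))) ?divff //.
Qed.

Lemma local_view_hop_graph n (G : wgraph n) E v :
  local_view (hop_graph G E) v = hop_row E v (local_view G v).
Proof. by apply/ffunP => u; rewrite ffunE. Qed.

Lemma size_flatten_le_real (R : realType) (T : eqType) (S : R) (Es : seq (seq T)) :
  (forall E, E \in Es -> (size E)%:R <= S) -> (size (flatten Es))%:R <= (size Es)%:R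
    * S.
Proof.
elim: Es => [|E Es IH] le /=; first by rewrite mul0r.
rewrite size_cat natrD -natr1 mulrDl mul1r addrC lerD ?le ?mem_head //.
by apply: IH => E' E'Es; apply: le; rewrite inE E'Es orbT.
Qed.

Lemma up_log_le_log2 (R : realType) (L : nat) : (2 <= L)%N ->
  (up_log 2 L)%:R <= 2 * log2 (L%:R : R).
Proof.
move=> L2; have /andP[lt _] := up_log_bounds (isT : (1 < 2)%N) L2.
have : (up_log 2 L).-1%:R <= log2 (L%:R : R).
  rewrite -(log2_pow R (up_log 2 L).-1); apply: ler_log2; first by rewrite exprn_gt0.
  by rewrite -natrX ler_nat ltnW.
have : 1 <= log2 (L%:R : R).
  apply: (@le_trans _ _ (log2 (2 ^+ 1))); first by rewrite log2_pow.
  by apply: ler_log2; rewrite ?exprn_gt0 // -natrX ler_nat.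
have K0 : (0 < up_log 2 L)%N by rewrite up_log_gt0.
have -> : (up_log 2 L)%:R = (up_log 2 L).-1%:R + 1 :> R by rewrite natr1 prednK.
by lra.
Qed.

(** Truncation at most halves [t], so the quotient times [t] is at most [2 * K <= 4 * x]; the
    successor adds [t <= x]. *)
Lemma groups_le (R : realType) (K : nat) (t x : R) : 1 <= t -> t <= x ->
  K%:R <= 2 * x ->
  (K %/ Num.truncn t).+1%:R * t <= 5 * x.
Proof.
move=> t1 tx Kx; have /andP[_ tt] := truncn_itv (le_trans ler01 t1).
have tau1 : 1 <= (Num.truncn t)%:R :> R by rewrite ler1n truncn_gt0.
have : (K %/ Num.truncn t)%:R * (Num.truncn t)%:R <= K%:R :> R.
  by rewrite -natrM ler_nat leq_divM.
have := ler0n R (K %/ Num.truncn t).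
move: tt; rewrite -(natr1 (Num.truncn t)) -(natr1 (K %/ _)).
set q := (K %/ _)%:R; set y := (Num.truncn t)%:R in tau1 *; move=> tt q0 le.
have : q * t <= q * (2 * y) by apply: ler_wpM2l => //; lra.
by lra.
Qed.

(** The choice of [y] makes [y * (eps / g)] equal to [c * l.+1], where [eps / g] is the error
    allowed per group. As [y] is at least 192, the additive 18 costs at most a factor 2. *)
Lemma hop_base_bounds (R : realType) (l g : nat) (c eps y : R) : 192 <= c ->
  0 < eps -> eps < 1 -> (0 < g)%N ->
  y = c * l.+1%:R * g%:R / eps ->
  [/\ (2 * l <= Num.truncn y + 18)%N, (Num.truncn y + 18)%N%:R <= 2 * y &
    192 * l%:R <= (Num.truncn y + 18)%N%:R * (eps / g%:R)].
Proof.
move=> c192 e0 e1 g0 yE; have g1 : 1 <= g%:R :> R by rewrite ler1n.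
have l1 : l.+1%:R = l%:R + 1 :> R by rewrite natr1.
have l0 := ler0n R l.
have y_ge : c * l.+1%:R <= y.
  rewrite yE -mulrA; apply: ler_peMr; first by rewrite mulr_ge0 //; lra.
  by rewrite ler_pdivlMr // mul1r; lra.
have cl : 192 * l.+1%:R <= c * l.+1%:R by rewrite ler_wpM2r.
have y0 : 0 <= y by lra.
have /andP[ty yt] := truncn_itv y0; rewrite -natr1 in yt.
have ye : y * (eps / g%:R) = c * l.+1%:R.
  by rewrite yE mulrA divfK ?gt_eqF // mulfK // gt_eqF // (lt_le_trans _ g1).
split.
- by rewrite -(ler_nat R) natrM natrD; lra.
- by rewrite natrD; lra.
- apply: (@le_trans _ _ (y * (eps / g%:R))); first by rewrite ye; lra.
  rewrite ler_wpM2r ?divr_ge0 ?ler0n ?(ltW e0) // natrD; lra.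
Qed.

(** The constant comes from [3 * M <= 6 * y] and [6 * 2 * 5 = 60 <= 2 ^ 7], next to the [2 ^ 8] in
    [y]. The resulting base is at least 1, so the exponent [l] may be raised to [E]. *)
Lemma hopbound_le (R : realType) (l g M : nat) (E x eps t y : R) :
  0 < eps -> eps < 1 -> 1 <= t -> t <= x -> 1 <= E -> l%:R <= E ->
  g%:R * t <= 5 * x -> y = 2 ^+ 8 * l.+1%:R * g%:R / eps -> M%:R <= 2 * y ->
  ((3 * M) ^ l)%N%:R <= (2 ^+ 15 * (E * x / (eps * t))) `^ E.
Proof.
move=> e0 e1 t1 tx E1 lE gt yE My.
have t0 : 0 < t by lra.
have et : 0 < eps * t by rewrite mulr_gt0.
have X1 : 1 <= E * x / (eps * t).
  rewrite ler_pdivlMr // mul1r; apply: (@le_trans _ _ (1 * x));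
    last by rewrite ler_wpM2r //; lra.
  by rewrite mul1r; apply: le_trans tx; rewrite ger_pMl // ltW.
have base : 3 * M%:R <= 2 ^+ 15 * (E * x / (eps * t)).
  have g_le : g%:R <= 5 * x / t by rewrite ler_pdivlMr.
  have l1 : l.+1%:R <= 2 * E by rewrite -natr1; lra.
  have : l.+1%:R * g%:R <= 2 * E * (5 * x / t) by apply: ler_pM.
  move=> lg; have y_le : y <= 2 ^+ 8 * (2 * E * (5 * x / t)) / eps.
    by rewrite yE ler_pM2r ?invr_gt0 // -mulrA ler_pM2l.
  apply: (@le_trans _ _ (6 * y)); first by lra.
  apply: (@le_trans _ _ (6 * (2 ^+ 8 * (2 * E * (5 * x / t)) / eps)));
    first by rewrite ler_pM2l.
  have -> : 6 * (2 ^+ 8 * (2 * E * (5 * x / t)) / eps) = 2 ^+ 8 * (60 * (E * x / (eps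
    * t))).
    by field; rewrite !gt_eqF.
  rewrite -[15%N]/(8 + 7)%N exprD -[leRHS]mulrA ler_pM2l ?exprn_gt0 //.
  apply: ler_wpM2r; first by lra.
  by rewrite -natrX ler_nat.
have big : 1 <= 2 ^+ 15 * (E * x / (eps * t)).
  by rewrite mulr_ege1 // exprn_ege1 // ler1n.
have big0 := le_trans ler01 big.
rewrite natrX natrM; apply: (@le_trans _ _ ((2 ^+ 15 * (E * x / (eps * t))) ^+ l)).
  by apply: lerXn2r; rewrite ?nnegrE //; exact: mulr_ge0.
by rewrite -powR_mulrn //; exact: ler_powR.
Qed.

Lemma depth_le (tau beta : nat) : (0 < beta)%N ->
  (depth tau beta <= 5 * (2 ^ tau * beta))%N.
Proof.
move=> b0; rewrite /depth expnS mulSn -mulnA.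
have z0 : (0 < 2 ^ tau)%N by rewrite expn_gt0.
have := leq_pmulr (2 ^ tau) b0; have := leq_pmull beta z0.
by move: (2 ^ tau * beta)%N (2 ^ tau)%N => y z; lia.
Qed.

(** The factor [log2 n / rho] accounts for the phases: it bounds [log2 kappa], [1 / rho] and 1. The
    constants 2, 3, 5 and 4 for scales, phases, depth and list sizes multiply to 120. *)
Lemma rounds_bound (R : realType) (n K l beta smax : nat) (kappa rho t x nr : R) :
  (256 <= n)%N -> 0 < rho -> rho < 2^-1 -> 0 < kappa -> kappa <= log2 (n%:R : R) / 4 ->
  1 <= t -> 0 <= x -> K%:R <= 2 * x ->
  (0 < beta)%N -> smax%:R <= 4 * nr ->
  l%:R <= log2 kappa + rho^-1 ->
  (K * (l.+1 * (depth (Num.truncn t) beta * smax)))%N%:R <=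
    128 * (nr / rho * log2 n%:R * beta%:R * x * 2 `^ t).
Proof.
move=> n256 r0 r2 k0 kn t1 x0 Kx b0 sm lE.
set lg := log2 (n%:R : R) in kn *.
have lg8 : 8%:R <= lg.
  by rewrite -(log2_pow R 8); apply: ler_log2; rewrite ?exprn_gt0 // -natrX ler_nat.
have lgn : lg <= n%:R.
  rewrite -(log2_pow R n); apply: ler_log2; first by rewrite ltr0n (leq_trans _ n256).
  by rewrite -natrX ler_nat ltnW // ltn_expl.
have lk : log2 kappa <= lg by apply: ler_log2 => //; lra.
have ri : 1 <= rho^-1 by rewrite invf_ge1 //; lra.
have l_le : l.+1%:R <= 3 * (lg / rho).
  have h1 : lg <= lg / rho by rewrite ler_peMr //; lra.
  have h2 : rho^-1 <= lg / rho by rewrite ler_peMl //; lra.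
  by rewrite -natr1; lra.
have beta1 : 1 <= beta%:R :> R by rewrite ler1n.
set tau := Num.truncn t.
have tau_t : 2 ^+ tau <= 2 `^ t :> R.
  by rewrite -powR_mulrn // ler_powR ?ler1n // truncn_le; lra.
have dep : (depth tau beta)%:R <= 5 * (2 `^ t * beta%:R).
  apply: (@le_trans _ _ (5 * (2 ^+ tau * beta%:R))); last first.
    by rewrite ler_pM2l // ler_wpM2r.
  by rewrite -natrX -!natrM ler_nat depth_le.
have nr0 : 0 <= nr by have := ler0n R smax; lra.
rewrite !natrM; set P := 2 `^ t * beta%:R; have P0 : 0 <= P by rewrite mulr_ge0
  ?powR_ge0.
have lr0 : 0 <= lg / rho by rewrite divr_ge0 //; lra.
apply: (@le_trans _ _ (2 * x * (3 * (lg / rho) * (5 * P * (4 * nr))))).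
  have le1 : (depth tau beta)%:R * smax%:R <= 5 * P * (4 * nr) by apply: ler_pM.
  have le2 : l.+1%:R * ((depth tau beta)%:R * smax%:R) <=
      3 * (lg / rho) * (5 * P * (4 * nr)) by apply: ler_pM => //; exact: mulr_ge0.
  by apply: ler_pM => //; apply: mulr_ge0 => //; exact: mulr_ge0.
have -> : 2 * x * (3 * (lg / rho) * (5 * P * (4 * nr))) =
  120 * (nr / rho * lg * beta%:R * x * 2 `^ t) by rewrite /P; field; rewrite gt_eqF.
apply: ler_wpM2r; last by rewrite ler_nat.
have lg0 : 0 <= lg by lra.
have ri0 : 0 <= rho^-1 by lra.
by do 5! [apply: mulr_ge0 => //]; exact: powR_ge0.
Qed.

(** Thresholds are bounded by [4 * 2 ^ K], while [2 ^ K < 2 * L]: the vertex identity used as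
    leading digit absorbs a factor 8. *)
Lemma pow2_encodable (n L K : nat) : (256 <= n)%N -> (2 ^ K.-1 < L)%N -> (0 < K)%N ->
  (4 * 2 ^ K < n * L.+1)%N.
Proof.
move=> n256 + K0; rewrite -{2}(prednK K0) expnS => xL.
apply: leq_trans (leq_mul (leq_trans (isT : (8 <= 256)%N) n256) (leqnn L.+1)).
by move: (2 ^ _)%N xL => x; lia.
Qed.

Theorem theorem3p12 (R : realType) :
  exists (K : nat) (C c : R), 0 < C /\ 0 < c /\
  forall (n Lambda : nat) (kappa rho t eps : R),
    2 <= kappa -> kappa <= log2 (n%:R : R) / 4 ->
    rho < 2^-1 -> kappa^-1 <= rho ->
    1 <= t -> t <= log2 (Lambda%:R : R) ->
    0 < eps -> eps < 1 ->
  exists beta : nat,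
    let logL : R := log2 Lambda%:R in
    let rounds : R :=
      C * (n%:R `^ rho / rho * log2 n%:R * beta%:R * logL * 2 `^ t) in
    beta%:R <= (C * ((log2 kappa + rho^-1) * logL / (eps * t)))
                 `^ (log2 kappa + rho^-1) /\
    (exists A : cc_alg n Lambda K, forall G : wgraph n,
       min_distance R G = 1%:E -> diameter R G = Lambda%:R%:E ->
       solves A G (is_hopset beta eps G)
         (C * (n%:R `^ (1 + kappa^-1) * logL)) rounds c) /\
    (forall k : nat,
     exists A : cc_alg n Lambda K, forall G : wgraph n,
       min_distance R G = 1%:E -> diameter R G = Lambda%:R%:E ->
       solves A G (is_scale_hopset beta eps k G)
         (C * n%:R `^ (1 + kappa^-1)) rounds c).
Proof.
pose C : R := 2 ^+ 15; have C0 : 0 < C by rewrite exprn_gt0.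
have C128 : 128 <= C by rewrite -[128]/(2 ^ 7)%:R natrX ler_weXn2l // ler1n.
have c192 : 192 <= 2 ^+ 8 :> R by rewrite -natrX ler_nat.
exists 3%N, C, 1; split=> //; split=> // n L kappa rho t eps k2 kn r2 kr t1 tL eps0
  eps1.
set lgn := log2 (n%:R : R) in kn *; set lgL := log2 (L%:R : R) in tL *.
have n256 : (256 <= n)%N.
  have : 2 ^+ 8 <= n%:R :> R by apply: le_log2 => //; rewrite -/lgn; lra.
  by rewrite -natrX ler_nat.
have L2 : (2 <= L)%N.
  have : 2 ^+ 1 <= L%:R :> R by apply: le_log2 => //; rewrite -/lgL; lra.
  by rewrite -natrX ler_nat.
have [l [s [lE s_ok sizes]]] : exists (l : nat) (s : nat -> nat), _ :=
  @degrees_exist R n kappa rho (leq_trans (isT : (1 < 256)%N) n256) k2 r2 kr.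
set nr : R := n%:R `^ rho in s_ok *; set nk : R := n%:R `^ (1 + kappa^-1) in sizes *.
(* The [K] scales fall into at most [Gr] groups of [tau], and each group may add [eps / Gr] to the
   error. *)
pose tau := Num.truncn t; pose K := up_log 2 L; pose Gr := (K %/ tau).+1.
pose e : R := eps / Gr%:R.
pose M := (Num.truncn (2 ^+ 8 * l.+1%:R * Gr%:R / eps) + 18)%N.
pose beta := ((3 * M) ^ l)%N; pose smax := Num.truncn (4 * nr).
have k0 : 0 < kappa by lra.
have r0 : 0 < rho by apply: lt_le_trans kr; rewrite invr_gt0.
have E1 : 1 <= log2 kappa + rho^-1.
  have : 2^-1^-1 <= rho^-1 by rewrite lef_pV2 ?posrE ?invr_gt0 // ltW.
  have : log2 (2 ^+ 1 : R) <= log2 kappa by apply: ler_log2.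
  by rewrite invrK log2_pow; lra.
have lgL0 : 0 <= lgL by apply: le_trans tL; apply: le_trans t1.
have K_lgL : K%:R <= 2 * lgL by exact: up_log_le_log2.
have [Ml My eM] := hop_base_bounds (c := 2 ^+ 8) (l := l) (g :=
  Gr) c192 eps0 eps1 isT erefl.
have beta_le : beta%:R <= (C * ((log2 kappa + rho^-1) * lgL / (eps * t)))
                 `^ (log2 kappa + rho^-1).
  exact: (hopbound_le eps0 eps1 t1 tL E1 lE (groups_le t1 tL K_lgL) erefl My).
have beta0 : (0 < beta)%N by rewrite expn_gt0 muln_gt0 addn_gt0 orbT.
have smax_le : smax%:R <= 4 * nr by rewrite truncn_le mulr_ge0 ?powR_ge0.
have rounds_le : (K * (l.+1 * (depth tau beta * smax)))%N%:R <=
   C * (nr / rho * lgn * beta%:R * lgL * 2 `^ t).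
  apply: le_trans (rounds_bound n256 r0 r2 k0 kn t1 lgL0 K_lgL beta0 smax_le lE) _.
  apply: ler_wpM2r => //; have lgn0 : 0 <= lgn by lra.
  have ri0 : 0 <= rho^-1 by rewrite invr_ge0 ltW.
  by do 5! [apply: mulr_ge0 => //]; exact: powR_ge0.
have nk0 : 0 <= nk by rewrite powR_ge0.
have tau0 : (0 < tau)%N by rewrite truncn_gt0.
have M18 : (18 <= M)%N by rewrite leq_addl.
have Gr0 : 0 < Gr%:R :> R by rewrite ltr0n.
have e0 : 0 <= e by rewrite divr_ge0 // ltW.
have Gre : Gr%:R * e = eps by rewrite /e mulrC divfK // gt_eqF.
have eK k : (k < K)%N -> (k %/ tau).+1%:R * e <= 1.
  move=> kK; apply: le_trans (_ : Gr%:R * e <= 1); last by rewrite Gre ltW.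
  by rewrite ler_wpM2r // ler_nat ltnS leq_div2r // ltnW.
have betaE : (hops M l <= beta)%N by exact: hops_le.
have s_ok' i : (i <= l)%N -> (0 < s i <= smax)%N.
  have [-> le] := s_ok i => _ /=; rewrite truncn_ge_nat //.
  by rewrite mulr_ge0 ?powR_ge0.
have /andP[KL LK] : (2 ^ K.-1 < L <= 2 ^ K)%N by exact: up_log_bounds.
have K_ok : (4 * 2 ^ K < n * L.+1)%N by apply: pow2_encodable; rewrite // up_log_gt0.
have sizes' m (m0 : m 0%N = n) mS := sizes m m0 mS.
pose p := all_scales n L M l tau beta s K.
exists beta => /=; split=> //; split.
- exists (@alg_of n L _ p (fun Es => hop_row (flatten Es))) => G _ diamG.
  have [d [dG distE dL]] := dist_metric diamG.
  have [le [sz good]] := yields_all_scales dG M18 Ml tau0 e0 eM eK betaE s_ok' K_ok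
    sizes'.
  set Es := result _ _ in sz good.
  apply: (@solves_deterministic _ _ _ _ _ _ _ (hop_graph G (flatten Es))).
  + exact: local_view_hop_graph.
  + have gs : good_scales tau beta G d e (16 * nk) K Es by split.
    have sE : sound d (flatten Es) by have := sound_flatten gs;
      rewrite -[in X in _ -> X](take_size Es).
    move=> u v; rewrite distE; split.
      by apply: hop_dist_ge_walk => D; exact: augment_walk_ge.
    have [j jK||D wk Dle] := good_scales_walk dG M18 Ml tau0 e0 eM betaE K_ok gs
      (leqnn K) (f := Gr) (u := u) (v := v).
    * by rewrite ltnS leq_div2r // ltnW.
    * exact: leq_trans (dL u v) LK.
    rewrite -sz take_size in wk; apply: le_trans (hop_dist_le_walk R wk) _.
    by rewrite -EFinM lee_fin -{1}Gre.
  + apply: (@le_trans _ _ (size (flatten Es))%:R);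
    first by rewrite ler_nat num_edges_hop_graph.
    apply: le_trans (size_flatten_le_real (S := 16 * nk) _) _.
      by move=> E /(nthP [::])[j]; rewrite sz => /good[_ ? _] <-.
    rewrite sz; apply: le_trans (ler_wpM2r (mulr_ge0 nk0 lgL0) C128).
    apply: (@le_trans _ _ (2 * lgL * (16 * nk)));
      first by rewrite ler_wpM2r // mulr_ge0.
    have -> : 2 * lgL * (16 * nk) = 32 * (nk * lgL) by ring.
    by apply: ler_wpM2r; [exact: mulr_ge0|rewrite ler_nat].
  + by apply: le_trans rounds_le; rewrite ler_nat.
(* The whole construction is run and only the edges of scale [k] are output. For [k >= K] the
   default list is empty, which suffices because no distance exceeds [L <= 2 ^ K]. *)
- move=> k; exists (@alg_of n L _ p (fun Es => hop_row (nth [::] Es k))) => G _ diamG.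
  have [d [dG distE dL]] := dist_metric diamG.
  have [le [sz good]] := yields_all_scales dG M18 Ml tau0 e0 eM eK betaE s_ok' K_ok
    sizes'.
  set Es := result _ _ in sz good.
  apply: (@solves_deterministic _ _ _ _ _ _ _ (hop_graph G (nth [::] Es k))).
  + exact: local_view_hop_graph.
  + have sE : sound d (nth [::] Es k).
      have [kK|Kk] := ltnP k K; first by have [] := good k kK.
      by rewrite nth_default ?sz.
    split=> u v; rewrite distE.
      by apply: hop_dist_ge_walk => D; exact: augment_walk_ge.
    rewrite !lte_fin !lee_fin -!natrX ltr_nat ler_nat => lo hi.
    have kK : (k < K)%N.
      rewrite -(ltn_exp2l _ _ (isT : (1 < 2)%N)); apply: leq_trans lo _.
      exact: leq_trans (dL u v) LK.
    have [_ _ /(_ u v)] := good k kK; rewrite lo hi => /(_ isT)[D wk Dle].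
    apply: le_trans (hop_dist_le_walk R wk) _; rewrite -EFinM lee_fin.
    apply: le_trans Dle _; rewrite ler_wpM2r // lerD2l -Gre ler_wpM2r // ler_nat.
    by rewrite ltnS leq_div2r // ltnW.
  + apply: (@le_trans _ _ (size (nth [::] Es k))%:R);
    first by rewrite ler_nat num_edges_hop_graph.
    have [kK|Kk] := ltnP k K; last by rewrite nth_default ?sz //;
      exact: mulr_ge0 (ltW C0) nk0.
    have [_ le16 _] := good k kK; apply: le_trans le16 _; apply: ler_wpM2r => //.
    by apply: le_trans C128; rewrite ler_nat.
  + by apply: le_trans rounds_le; rewrite ler_nat.
Qed.
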